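(* For all $n\in\mathbb{N}$ (i.e. all integers $n\ge 0$), the characteristic polynomial of the matrix $\mathrm{Adj}_{B_n}$ divides the characteristic polynomial of the matrix $\mathrm{Adj}_{B_{n+1}}$.
   Context: For integers $p\le q$ put $[p,q]=\{p,\dots,q\}$ (empty if $p>q$). For $n\ge 0$, $\mathfrak{S}_n^{\pm}$ denotes the group (under composition) of signed permutations of rank $n$: permutations $\sigma$ of $[-n,n]$ with $\sigma(-i)=-\sigma(i)$ for all $i$ (so $\sigma(0)=0$). A signed permutation is written in window notation $(\sigma(1),\dots,\sigma(n))$. Let $s_0=(-1,2,\dots,n)$ and, for $1\le i\le n-1$, let $s_i$ be the signed permutation whose window is $(1,\dots,n)$ with $i$ and $i+1$ exchanged. The length $\ell(\sigma)$ is the minimal number of factors in an expression of $\sigma$ as a product of the generators $s_0,\dots,s_{n-1}$. The descent set is $\mathrm{Des}(\sigma)=\{i\in[0,n-1] : \ell(\sigma s_i)<\ell(\sigma)\}$; equivalently, $i\in\mathrm{Des}(\sigma)$ iff $\sigma(i)>\sigma(i+1)$, where $\sigma(0)=0$. $\mathrm{Adj}_{B_n}=(a_{\sigma,\tau})$ is the square matrix with rational entries indexed by the elements of $\mathfrak{S}_n^{\pm}$ given by $a_{\sigma,\tau}=1$ if $\mathrm{Des}(\tau^{-1})\subseteq\mathrm{Des}(\sigma)$ and $a_{\sigma,\tau}=0$ otherwise. (For $n=0$ this is the $1\times 1$ matrix $(1)$.) *)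

(* Defs.v *)
From HB Require Import structures.
From mathcomp Require Import all_boot all_order all_fingroup all_algebra.
From mathcomp Require Import zify.

Set Implicit Arguments.
Unset Strict Implicit.
Unset Printing Implicit Defensive.

(* The integer k of [-n, n] is encoded as the ordinal n + k of 'I_(2n + 1);
   k |-> - k is then rev_ord, and the order is preserved. *)
Definition pt (n k : nat) : 'I_n.*2.+1 := inord (n + k).

Definition signed_perm_set (n : nat) : {set {perm 'I_n.*2.+1}} :=
  [set s : {perm 'I_n.*2.+1} | [forall i, s (rev_ord i) == rev_ord (s i)]].

Lemma signed_permP n (s : {perm 'I_n.*2.+1}) :
  reflect (forall i, s (rev_ord i) = rev_ord (s i)) (s \in signed_perm_set n).
Proof.
by rewrite inE; apply: (iffP forallP) => h i; [apply/eqP | rewrite h].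
Qed.

Lemma signed_perm_group_set n : group_set (signed_perm_set n).
Proof.
apply/group_setP; split; first by apply/signed_permP => i; rewrite !perm1.
move=> s t /signed_permP hs /signed_permP ht; apply/signed_permP => i.
by rewrite !permM hs ht.
Qed.
Canonical signed_perm_group n := Group (@signed_perm_group_set n).

Notation signed_perm n := (subg_of (signed_perm_group n)).

(* The group law of mathcomp on permutations is (s * t) x = t (s x), the
   opposite of composition. *)
Definition scomp n (s t : signed_perm n) : signed_perm n := (t * s)%g.

Lemma scompE n (s t : signed_perm n) x :
  sgval (scomp s t) x = sgval s (sgval t x).
Proof. by rewrite /= permM. Qed.

Definition gen_perm n (i : nat) : {perm 'I_n.*2.+1} :=
  if i == 0 then tperm (rev_ord (pt n 1)) (pt n 1)
  else (tperm (pt n i) (pt n i.+1) *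
        tperm (rev_ord (pt n i)) (rev_ord (pt n i.+1)))%g.

Lemma val_pt n k : k <= n -> pt n k = n + k :> nat.
Proof. by move=> le_kn; rewrite inordK // ltnS -addnn leq_add2l. Qed.

Lemma val_rev_pt n k : k <= n -> rev_ord (pt n k) = n - k :> nat.
Proof. by move=> le_kn; rewrite /= val_pt // subSS -addnn subnDl. Qed.

Lemma pt_neq_rev n a b :
  0 < a -> a <= n -> b <= n -> pt n a != rev_ord (pt n b).
Proof.
move=> a_gt0 le_an le_bn; apply/eqP => /(congr1 (@nat_of_ord _)).
by rewrite val_rev_pt // val_pt //; lia.
Qed.

Lemma gen_perm_signed n (i : 'I_n) : gen_perm n i \in signed_perm_set n.
Proof.
have tpermR (x y z : 'I_n.*2.+1) :
    rev_ord (tperm x y z) = tperm (rev_ord x) (rev_ord y) (rev_ord z).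
  exact/inj_tperm/rev_ord_inj.
have i1 := ltnW (ltn_ord i); have i2 := ltn_ord i.
apply/signed_permP => x; rewrite /gen_perm; case: ifP => i0.
  by rewrite tpermR rev_ordK tpermC.
have i0' : 0 < i by rewrite lt0n i0.
rewrite !permM !tpermR !rev_ordK -!permM; congr (fun_of_perm _ _).
suff /conjg_fixP: (tperm (pt n i) (pt n i.+1) ^
    tperm (rev_ord (pt n i)) (rev_ord (pt n i.+1)))%g =
    tperm (pt n i) (pt n i.+1) by move/commgP.
by rewrite tpermJ !tpermD // eq_sym pt_neq_rev.
Qed.

Definition sgen n (i : 'I_n) : signed_perm n := Subg (gen_perm_signed i).

Definition sgen_prod n (w : seq 'I_n) : signed_perm n :=
  foldr (fun i s => scomp (sgen i) s) 1%g w.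

Definition moment N (s : {perm 'I_N}) := \sum_(x : 'I_N) x * s x.

Lemma moment_le N (s : {perm 'I_N}) : moment s <= N * (N * N).
Proof.
rewrite -[X in X * _]card_ord -sum_nat_const; apply: leq_sum => x _.
by rewrite leq_mul // ltnW.
Qed.

Lemma moment_tperm N (s : {perm 'I_N}) (a b : 'I_N) :
  a < b -> s b < s a -> moment s < moment (tperm a b * s)%g.
Proof.
move=> ab sba; have ba : b != a by rewrite neq_ltn ab orbT.
rewrite /moment (bigD1 a) // (bigD1 b) //= addnA.
rewrite [X in _ < X](bigD1 a) // [X in _ < _ + X](bigD1 b) //= addnA.
rewrite !permM tpermL tpermR.
set A := \sum_(i | _) _; set B := \sum_(i | _) _.
have -> : B = A.
  by apply: eq_bigr => x /andP[xa xb]; rewrite permM tpermD // eq_sym.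
rewrite ltn_add2r -(subnKC (ltnW ab)) -(subnKC (ltnW sba)).
rewrite !mulnDl !mulnDr -!addnA !ltn_add2l.
rewrite -subn_gt0 in ab; rewrite -subn_gt0 in sba.
have := muln_gt0 (b - a) (s a - s b); rewrite ab sba.
lia.
Qed.

Lemma moment_gen n (s : signed_perm n) (i : 'I_n) :
  sgval s (pt n i.+1) < sgval s (pt n i) ->
  moment (sgval s) < moment (sgval (scomp s (sgen i))).
Proof.
have i1 := ltnW (ltn_ord i); have i2 := ltn_ord i.
case: s => s /= /signed_permP hs des; rewrite /gen_perm; case: ifP => i0.
  move: des; rewrite (eqP i0) => des.
  have e0 : rev_ord (pt n 0) = pt n 0.
    by apply: ord_inj; rewrite val_rev_pt // val_pt // addn0 subn0.
  have s0 : s (pt n 0) = n :> nat.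
    have /(congr1 (@nat_of_ord _)) /= := hs (pt n 0); rewrite e0; lia.
  have n1 : 1 <= n by lia.
  apply: moment_tperm; first by rewrite val_rev_pt // val_pt //; lia.
  rewrite hs /=; rewrite s0 in des; lia.
have i0' : 0 < i by rewrite lt0n i0.
rewrite -mulgA.
have dest : s (rev_ord (pt n i)) < s (rev_ord (pt n i.+1)).
  rewrite !hs /=; have := ltn_ord (s (pt n i)); lia.
apply: (@ltn_trans (moment (tperm (rev_ord (pt n i)) (rev_ord (pt n i.+1)) * s)%g)).
  rewrite tpermC; apply: moment_tperm => //.
  rewrite !val_rev_pt //; lia.
apply: moment_tperm; first by rewrite !val_pt //; lia.
by rewrite !permM !tpermD // eq_sym pt_neq_rev.
Qed.

Lemma no_descent_id n (s : signed_perm n) :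
  (forall i : 'I_n, sgval s (pt n i) <= sgval s (pt n i.+1)) -> s = 1%g.
Proof.
case: s => s hs0 /= nd; apply: val_inj => /=.
have /signed_permP hs := hs0.
have lt k : k < n -> s (pt n k) < s (pt n k.+1).
  move=> kn; have := nd (Ordinal kn); rewrite /= leq_eqVlt => /orP[/eqP e|//].
  have := congr1 (@nat_of_ord _) (perm_inj (ord_inj e)).
  by rewrite !val_pt //; lia.
have e0 : rev_ord (pt n 0) = pt n 0.
  by apply: ord_inj; rewrite val_rev_pt // val_pt // addn0 subn0.
have s0 : s (pt n 0) = n :> nat.
  have /(congr1 (@nat_of_ord _)) /= := hs (pt n 0); rewrite e0; lia.
have low k : k <= n -> n + k <= s (pt n k).
  elim: k => [|k IH] kn; first by rewrite s0; lia.
  have := lt k kn; have := IH (ltnW kn); lia.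
have up k : k <= n -> s (pt n (n - k)) + k <= n.*2.
  elim: k => [|k IH] kn.
    by have := ltn_ord (s (pt n (n - 0))); lia.
  have h : n - k.+1 < n by lia.
  have := lt _ h; have := IH (ltnW kn).
  have -> : (n - k.+1).+1 = n - k by lia.
  lia.
have fix_pt k : k <= n -> s (pt n k) = pt n k.
  move=> kn; apply: ord_inj; rewrite val_pt //.
  have := low k kn; have := up (n - k) (leq_subr _ _).
  rewrite subKn //; lia.
apply/permP => x; rewrite perm1; have := ltn_ord x => xn.
case: (leqP n x) => nx.
  have -> : x = pt n (x - n) by apply: ord_inj; rewrite val_pt; lia.
  by apply: fix_pt; lia.
have -> : x = rev_ord (pt n (n - x)).
  by apply: ord_inj; rewrite val_rev_pt /=; lia.
by rewrite hs fix_pt //; lia.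
Qed.

Lemma sgenK n (i : 'I_n) : scomp (sgen i) (sgen i) = 1%g.
Proof.
have i1 := ltnW (ltn_ord i); have i2 := ltn_ord i.
apply: val_inj; rewrite /= /gen_perm; case: ifP => i0; first exact: tperm2.
have i0' : 0 < i by rewrite lt0n i0.
apply/permP => x; rewrite !permM perm1.
have e y : tperm (rev_ord (pt n i)) (rev_ord (pt n i.+1))
    (tperm (pt n i) (pt n i.+1) y) = tperm (pt n i) (pt n i.+1)
    (tperm (rev_ord (pt n i)) (rev_ord (pt n i.+1)) y).
  rewrite (inj_tperm _ _ _ (@perm_inj _ _)).
  by rewrite [tperm (rev_ord _) _ (pt n i)]tpermD
             ?[tperm (rev_ord _) _ (pt n i.+1)]tpermD // eq_sym pt_neq_rev.
by rewrite e !tpermK.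
Qed.

Lemma sgen_prod_rcons n (w : seq 'I_n) i :
  sgen_prod (rcons w i) = scomp (sgen_prod w) (sgen i).
Proof.
elim: w => [|j w IH] /=; first by rewrite /scomp mul1g mulg1.
by rewrite IH /scomp mulgA.
Qed.

Lemma sgen_prod_exists n (s : signed_perm n) :
  exists k, [exists w : k.-tuple 'I_n, sgen_prod w == s].
Proof.
suff [w ws]: exists w, sgen_prod w = s.
  by exists (size w); apply/existsP; exists (in_tuple w); rewrite ws.
pose B N := N * (N * N).
have [m] := ubnP (B n.*2.+1 - moment (sgval s)).
elim: m s => // m IH s hm.
case: (pickP (fun i : 'I_n => sgval s (pt n i.+1) < sgval s (pt n i))); last first.
  move=> nd; exists [::]; apply/esym/no_descent_id => i.
  by rewrite leqNgt nd.
move=> i /moment_gen lt.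
have := moment_le (sgval (scomp s (sgen i))); rewrite -/(B _) => leB.
case: (IH (scomp s (sgen i))) => [|w ws]; first by lia.
exists (rcons w i); rewrite sgen_prod_rcons ws.
have := sgenK i; rewrite /scomp => ii.
by rewrite mulgA ii mul1g.
Qed.

Definition slength n (s : signed_perm n) : nat := ex_minn (sgen_prod_exists s).

Definition Des n (s : signed_perm n) : {set 'I_n} :=
  [set i | slength (scomp s (sgen i)) < slength s].

(* Rows and columns are numbered by the library's enumeration of the group;
   the characteristic polynomial does not depend on it. *)
Definition AdjB (n : nat) : 'M[rat]_#|{: signed_perm n}| :=
  (\matrix_(i, j)
     (Des (enum_val j)^-1%g \subset Des (enum_val i))%:R)%R.

(* Main.v *)
Require Import Defs.
From mathcomp Require Import all_boot all_order all_fingroup all_algebra.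
From mathcomp Require Import zify ring.

(** A signed permutation enters the matrix only through two subsets of
[0, n-1], its descent set and that of its inverse.  By inclusion-exclusion,
[Des t^-1 \subset Des s] is the sum over all U of
(-1)^|~U| [Des s \subset U] [~U \subset Des t^-1], so that AdjB n = Y X where
the columns of Y and the rows of X are indexed by the 2^n subsets U
([AdjB_factor]).  As Y X and X Y have the same characteristic polynomial up to
a power of 'X ([char_poly_mulmxC]), and as the exponent |B_n| - 2^n of this
power increases with n ([leq_double_card]), it is enough to compare the
matrices R_n = X Y of size 2^n.  Their entry at (T, U) is, up to a sign that
depends on T only, the number of s with Des s \subset U and
~T \subset Des s^-1.

A subset T of [0, n-1] cuts the path 0 - 1 - ... - n into blocks, that is, it
encodes a composition (a_0; a_1, ..., a_k) of n in which only a_0 may be zero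
(a_0 is the size of the block of the vertex 0, not counting 0).  In the
algebra of quasi-symmetric functions of type B, R_n is the matrix of a linear
map in the basis of the monomial functions, the sums of
x_0^a_0 x_i1^a_1 ... x_ik^a_k over 0 < i1 < ... < ik.  This map commutes with
a derivation D of degree -1 that formally sends every variable to 1, with the
number of the variables x_1, x_2, ... normalised to -1: D sends a composition
to the sum over j of a_j times the composition with a_j decreased by one, with
a minus sign when the part a_j = 1 disappears (for j > 0).  On subsets, D is
the signed sum, over the vertices 1, ..., n of the path, of the removal of
that vertex ([contraction]).  It has full rank since it is triangular on the
compositions with a_0 > 0, where it lowers a_0 with the coefficient a_0
([contraction_kernel]).  Hence R_n+1 D = D R_n makes R_n the matrix of
the action of R_n+1 on an invariant subspace of the column vectors, the image
of D, and its characteristic polynomial is a factor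
([char_poly_dvd_intertwine]).

The commutation of D with R ([reduced_adj_contraction]) is the computation of
an Euler characteristic.  After D is applied to U, one sums over the signed
permutations of rank n + 1 with one marked point.  Remove the marked point,
and fix what remains together with the image of the marked point: its argument
then runs over gaps between consecutive arguments, and the signed sum over U
attaches to the gap g the difference L g - L (g + 1), where L g says that the
argument just below g has an image smaller than that of the marked point
([sum_des_in_insert]).  The condition on the descents of s^-1 restricts g to
an interval whose ends have L false and L true.  The sum telescopes to -1 if
this interval is not empty and to 0 if it is ([telescope_window]); and it is
not empty exactly when the shorter permutation satisfies the condition that
comes from T by removing a vertex. *)

Set Implicit Arguments.
Unset Strict Implicit.
Unset Printing Implicit Defensive.

Import GRing.Theory.

(** * Characteristic polynomials and intertwining matrices *)

Section CharPoly.
Local Open Scope ring_scope.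

(** The determinant of the block matrix with blocks 'X, U, V, 1 is computed in
two ways, by clearing either of its off-diagonal blocks. *)
Lemma char_poly_mulmxC (R : comNzRingType) m k (U : 'M[R]_(m, k)) (V : 'M_(k, m)) :
  char_poly (U *m V) * 'X^k = 'X^m * char_poly (V *m U).
Proof.
rewrite /char_poly /char_poly_mx !map_mxM.
set u := map_mx _ U; set v := map_mx _ V.
pose M := block_mx 'X%:M u v 1%:M : 'M[{poly R}]_(m + k).
have detL : \det M = \det ('X%:M - u *m v).
  have := det_mulmx M (block_mx 1%:M 0 (- v) 1%:M).
  rewrite mulmx_block !mulmx0 !mulmx1 !mul1mx add0r addrN !mulmxN add0r.
  by rewrite det_ublock det_lblock !det1 !mulr1.
have detR : \det M * 'X^k = 'X^m * \det ('X%:M - v *m u).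
  have detX j : 'X^j = \det ('X%:M : 'M[{poly R}]_j) by rewrite det_scalar.
  rewrite !detX.
  have := det_mulmx M (block_mx 1%:M (- u) 0 'X%:M).
  rewrite mulmx_block !mulmx0 !mulmx1 !mul1mx !addr0 !mulmxN.
  rewrite mul_scalar_mx mul_mx_scalar addNr [- _ + _]addrC.
  by rewrite det_ublock det_lblock det1 mul1r.
by rewrite -detL detR.
Qed.

Lemma char_poly_ublock (R : comNzRingType) m k (A : 'M[R]_m) B (C : 'M_k) :
  char_poly (block_mx A B 0 C) = char_poly A * char_poly C.
Proof.
rewrite /char_poly -(det_ublock _ (- map_mx polyC B)); congr (\det _).
rewrite /char_poly_mx map_block_mx map_mx0 scalar_mx_block.
by rewrite opp_block_mx add_block_mx oppr0 !add0r.
Qed.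

Lemma char_poly_conj (F : fieldType) m (P A B : 'M[F]_m) :
  P \in unitmx -> P *m A = B *m P -> char_poly A = char_poly B.
Proof.
move=> Pu eqP; have -> : A = invmx P *m (B *m P) by rewrite -eqP mulKmx.
apply: (@mulIf _ 'X^m); first by rewrite -size_poly_eq0 size_polyXn.
by rewrite char_poly_mulmxC -mulmxA mulmxV // mulmx1 mulrC.
Qed.

(** The image of D is a space of dimension k on which A acts as B.  In a basis
adapted to D, the matrix A becomes block triangular with a conjugate of B as
its first diagonal block. *)
Lemma char_poly_dvd_intertwine (F : fieldType) m k
    (A : 'M[F]_m) (B : 'M_k) (D : 'M_(m, k)) :
  row_full D -> A *m D = D *m B -> char_poly B %| char_poly A.
Proof.
move=> /eqP rkD AD; have [l eq_m] : exists l, m = (k + l)%N.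
  by exists (m - k)%N; rewrite subnKC // -[X in (X <= _)%N]rkD rank_leq_row.
move: eq_m A D rkD AD => -> {m} A D rkD AD.
pose L := col_ebase D; pose V := row_ebase D.
have Lu : L \in unitmx := col_ebase_unit D.
have Vu : V \in unitmx := row_ebase_unit D.
(* D = L [1; 0] V is the rank decomposition of D; conjugating A by L and B by V
   reduces to the case D = [1; 0] *)
have eqD : D = L *m col_mx 1%:M 0 *m V.
  by rewrite -{1}(mulmx_ebase D) rkD pid_mx_col.
pose A' := invmx L *m A *m L; pose B' := V *m B *m invmx V.
have A'c : A' *m col_mx 1%:M 0 = col_mx B' (0 : 'M_(l, k)).
  have -> : col_mx B' (0 : 'M_(l, k)) = col_mx 1%:M 0 *m B' by rewrite mul_col_mx mul1mx mul0mx.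
  have AD' := AD; rewrite eqD !mulmxA in AD'.
  apply: (can_inj (mulmxK Vu)); apply: (can_inj (mulKmx Lu)).
  by rewrite /A' /B' !mulmxA mulmxV // mul1mx AD' -[RHS]mulmxA mulVmx // mulmx1.
move: A'c; rewrite -[A']submxK mul_block_col !mulmx0 !addr0 !mulmx1.
case/eq_col_mx => eq_ul eq_dl.
have -> : char_poly A = char_poly A'.
  by apply/esym/(char_poly_conj Lu); rewrite /A' !mulmxA mulmxV // mul1mx.
rewrite -[A']submxK eq_ul eq_dl char_poly_ublock.
have <- : char_poly B = char_poly B'.
  by apply: (char_poly_conj Vu); rewrite /B' -mulmxA mulVmx // mulmx1.
exact: dvdp_mulIl.
Qed.
End CharPoly.

(** * Descents of signed permutations *)

(** The generators s_0 and s_i (i > 0) as relations between a point x and its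
image y; points of [-n, n] are shifted by n. *)
Definition swap0 (n x y : nat) :=
  [\/ x = n.+1 /\ y = n.-1, x = n.-1 /\ y = n.+1
    | [/\ x != n.+1, x != n.-1 & y = x]].

Definition swapS (n i x y : nat) :=
  [\/ x = n + i /\ y = n + i.+1, x = n + i.+1 /\ y = n + i,
     x = n - i /\ y = n - i.+1 | x = n - i.+1 /\ y = n - i] \/
  (x != n + i /\ x != n + i.+1) /\ [/\ x != n - i, x != n - i.+1 & y = x].

Definition nzlt n (a b : nat) := [&& a < b, a != n & b != n].

(** The pairs whose order is changed by s_0, respectively by s_i with i > 0. *)
Definition flip0 n (x y : nat) := (x == n.-1) && (y == n.+1).
Definition flipS n i (x y : nat) :=
  (x == n + i) && (y == n + i.+1) || (x == n - i.+1) && (y == n - i).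

Lemma swap0_nzlt n a b ga gb : 0 < n -> swap0 n a ga -> swap0 n b gb ->
  [/\ flip0 n a b -> nzlt n a b && ~~ nzlt n ga gb,
      flip0 n b a -> nzlt n ga gb && ~~ nzlt n a b,
      ~~ flip0 n a b -> ~~ flip0 n b a -> nzlt n a b = nzlt n ga gb
    & (ga + gb == n.*2) = (a + b == n.*2)].
Proof.
rewrite /flip0 /nzlt => n0.
by case=> [[-> ->]|[-> ->]|[ha1 ha2 ->]];
   case=> [[-> ->]|[-> ->]|[hb1 hb2 ->]]; split; lia.
Qed.

Lemma revSP n i x y : i < n ->
  reflect (y = x.+1 /\ (x = n + i \/ x = n - i.+1)) (flipS n i x y).
Proof.
move=> lin; rewrite /flipS.
apply: (iffP orP) => [[/andP[/eqP-> /eqP->]|/andP[/eqP-> /eqP->]]|[-> [->|->]]].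
- by rewrite addnS; split; [|left].
- by split; [lia|right].
- by left; rewrite addnS !eqxx.
- by right; rewrite eqxx; apply/eqP; lia.
Qed.

Lemma swapS_step n i x y : i < n -> swapS n i x y ->
  [\/ flipS n i x y, flipS n i y x |
   [/\ y = x, x <> n + i, x <> n + i.+1, x <> n - i & x <> n - i.+1]].
Proof.
move=> lin [[[-> ->]|[-> ->]|[-> ->]|[-> ->]]|].
- by constructor 1; rewrite /flipS !eqxx.
- by constructor 2; rewrite /flipS !eqxx.
- by constructor 2; rewrite /flipS !eqxx orbT.
- by constructor 1; rewrite /flipS !eqxx orbT.
by case=> [[/eqP ? /eqP ?] [/eqP ? /eqP ? ->]]; constructor 3.
Qed.

(** The generator s_i moves points by at most one, so it can only exchange the
order of two consecutive points, and then it swaps them. *)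
Lemma swapS_ltn n i a b ga gb : 0 < i < n ->
    swapS n i a ga -> swapS n i b gb -> a < b ->
  if flipS n i a b then gb < ga else ga < gb.
Proof.
case/andP=> i0 lin sa sb ab.
case: (revSP a b lin) => [[eb ea]|nab].
  case: (swapS_step lin sa) => [/(revSP _ _ lin)[-> _]|/(revSP _ _ lin)[ha hb]|[_ h1 h2 h3 h4]]; [|lia|lia].
  case: (swapS_step lin sb) => [/(revSP _ _ lin)[ha hb]|/(revSP _ _ lin)[ha hb]|[_ h1 h2 h3 h4]]; lia.
case: (swapS_step lin sa) => [/(revSP _ _ lin)[ha hb]|/(revSP _ _ lin)[ha hb]|[ha h1 h2 h3 h4]];
case: (swapS_step lin sb) => [/(revSP _ _ lin)[ha' hb']|/(revSP _ _ lin)[ha' hb']|[ha' h1' h2' h3' h4']];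
  lia.
Qed.

Lemma swapS_mid n i x y : 0 < i < n -> swapS n i x y -> (y == n) = (x == n).
Proof.
case/andP=> i0 lin /(swapS_step lin)[/(revSP _ _ lin)[ha hb]|/(revSP _ _ lin)[ha hb]|[-> //]].
  by apply/eqP/eqP; lia.
by apply/eqP/eqP; lia.
Qed.

Lemma swapS_fun n i x y z : 0 < i < n -> swapS n i x y -> swapS n i x z -> y = z.
Proof.
case/andP=> i0 lin /(swapS_step lin) sy /(swapS_step lin) sz.
case: sy => [/(revSP _ _ lin)[ha hb]|/(revSP _ _ lin)[ha hb]|[ha h1 h2 h3 h4]];
case: sz => [/(revSP _ _ lin)[ha' hb']|/(revSP _ _ lin)[ha' hb']|[ha' h1' h2' h3' h4']]; lia.
Qed.

Lemma swapS_sum n i a b ga gb : 0 < i < n -> swapS n i a ga -> swapS n i b gb ->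
  (ga + gb == n.*2) = (a + b == n.*2).
Proof.
case/andP=> i0 lin /(swapS_step lin) sa /(swapS_step lin) sb.
case: sa => [/(revSP _ _ lin)[ha hb]|/(revSP _ _ lin)[ha hb]|[ha h1 h2 h3 h4]];
case: sb => [/(revSP _ _ lin)[ha' hb']|/(revSP _ _ lin)[ha' hb']|[ha' h1' h2' h3' h4']].
all: by apply/eqP/eqP; lia.
Qed.

Lemma swapS_nzlt n i a b ga gb : 0 < i < n ->
    swapS n i a ga -> swapS n i b gb ->
  [/\ flipS n i a b -> nzlt n a b && ~~ nzlt n ga gb,
      flipS n i b a -> nzlt n ga gb && ~~ nzlt n a b,
      ~~ flipS n i a b -> ~~ flipS n i b a -> nzlt n a b = nzlt n ga gb
    & (ga + gb == n.*2) = (a + b == n.*2)].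
Proof.
move=> lin sa sb; have [i0 lin'] := andP lin.
have mid := (swapS_mid lin sa, swapS_mid lin sb).
have ltS x y : flipS n i x y -> [/\ x < y, x != n & y != n].
  by case/(revSP _ _ lin') => -> h; split=> //; apply/eqP; lia.
rewrite /nzlt !mid; split.
- move=> rab; have [ab a0 b0] := ltS _ _ rab; rewrite ab a0 b0 !andbT /=.
  by have := swapS_ltn lin sa sb ab; rewrite rab -leqNgt => /ltnW.
- move=> rba; have [ba b0 a0] := ltS _ _ rba.
  have := swapS_ltn lin sb sa ba; rewrite rba => ->.
  by rewrite a0 b0 ltnNge (ltnW ba).
- move=> /negPf nab /negPf nba; congr (_ && _).
  case: (ltngtP a b) => [ab|ba|eab].
  + by have := swapS_ltn lin sa sb ab; rewrite nab => ->.
  + by have := swapS_ltn lin sb sa ba; rewrite nba => h; rewrite ltnNge (ltnW h).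
  + by rewrite eab in sa; rewrite (swapS_fun lin sa sb) ltnn.
- exact: swapS_sum lin sa sb.
Qed.

Section App.
Variable n : nat.
Implicit Types (s t : signed_perm n) (x y : nat).

Definition spval s x : nat := sgval s (inord x).

Lemma spval_le s x : spval s x <= n.*2.
Proof. by rewrite -ltnS ltn_ord. Qed.

Lemma spval_ord s (x : 'I_n.*2.+1) : spval s x = sgval s x :> nat.
Proof. by rewrite /spval inord_val. Qed.

Lemma spval_inj s x y : x <= n.*2 -> y <= n.*2 -> spval s x = spval s y -> x = y.
Proof.
move=> xn yn /ord_inj/perm_inj/(congr1 (@nat_of_ord _)).
by rewrite !inordK.
Qed.

Lemma spval_rev s x : x <= n.*2 -> spval s (n.*2 - x) = n.*2 - spval s x.
Proof.
move=> xn; have /signed_permP/(_ (inord x)) := subgP s.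
move/(congr1 (@nat_of_ord _)); rewrite /= subSS => <-; rewrite /spval.
by congr (nat_of_ord (fun_of_perm _ _)); apply: ord_inj; rewrite /= !inordK //; lia.
Qed.

Lemma spval_mid s : spval s n = n.
Proof. by have := @spval_rev s n; rewrite -addnn addnK; have := spval_le s n; lia. Qed.

Lemma spval_invK s x : x <= n.*2 -> spval s^-1%g (spval s x) = x.
Proof. by move=> xn; rewrite /spval inord_val /= permK inordK. Qed.

Lemma spval_Kinv s x : x <= n.*2 -> spval s (spval s^-1%g x) = x.
Proof. by move=> xn; rewrite /spval inord_val /= permKV inordK. Qed.

Lemma spval_ext s t : (forall x, x <= n.*2 -> spval s x = spval t x) -> s = t.
Proof.
move=> eq_st; apply/val_inj/permP => x; apply: ord_inj.
by rewrite -!spval_ord eq_st // -ltnS.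
Qed.

Lemma spval_scomp s (i : 'I_n) x :
  spval (scomp s (sgen i)) x = spval s (gen_perm n i (inord x)).
Proof. by rewrite /spval scompE inord_val. Qed.

Lemma gen_perm0 (x : 'I_n.*2.+1) : 0 < n -> swap0 n x (gen_perm n 0 x).
Proof.
move=> n0; rewrite /swap0 /gen_perm eqxx permE /=.
have e1 : rev_ord (pt n 1) = n.-1 :> nat by rewrite val_rev_pt // subn1.
have e2 : pt n 1 = n.+1 :> nat by rewrite val_pt // addn1.
rewrite -!(inj_eq (@ord_inj _)) e1 e2.
case: eqP => [->|/eqP h1]; first by constructor 2.
case: eqP => [->|/eqP h2]; first by constructor 1.
by constructor 3.
Qed.

Lemma gen_permS i (x : 'I_n.*2.+1) : 0 < i < n -> swapS n i x (gen_perm n i x).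
Proof.
case/andP=> i0 lin; rewrite /swapS /gen_perm eqn0Ngt i0 /= permM.
have e1 : rev_ord (pt n i) = n - i :> nat by rewrite val_rev_pt // ltnW.
have e2 : rev_ord (pt n i.+1) = n - i.+1 :> nat by rewrite val_rev_pt.
have e3 : pt n i = n + i :> nat by rewrite val_pt // ltnW.
have e4 : pt n i.+1 = n + i.+1 :> nat by rewrite val_pt.
have neq (a b : 'I_n.*2.+1) : a <> b -> a <> b :> nat by move=> ab /ord_inj.
case: (tpermP (pt n i)) => [->|->|/neq h1 /neq h2]; (case: tpermP =>
  [/(congr1 (@nat_of_ord _)) h3|/(congr1 (@nat_of_ord _)) h3|/neq h3 /neq h4]);
  try (exfalso; lia); rewrite ?e1 ?e2 ?e3 ?e4.
- by left; apply: Or41.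
- by left; apply: Or42.
- by left; apply: Or43; rewrite h3 e1.
- by left; apply: Or44; rewrite h3 e2.
- rewrite e3 in h1; rewrite e4 in h2; rewrite e1 in h3; rewrite e2 in h4.
  by right; do 2!split; apply/eqP.
Qed.

(** Twice the Coxeter length: s_0 changes the order of the single pair (-1, 1)
and s_i that of the two pairs (i, i+1) and (-i-1, -i), so opposite points are
given the weight 2 to make every generator change the count by 2. *)
Definition winv s :=
  \sum_(p : 'I_n.*2.+1 * 'I_n.*2.+1)
    (nzlt n p.1 p.2 && (spval s p.2 < spval s p.1)) * (p.1 + p.2 == n.*2).+1.

(** Reindexing the pairs by the generator preserves all terms except those of
the pairs that it flips. *)
Lemma winv_descent s (i : 'I_n) :
  spval s (n + i.+1) < spval s (n + i) -> winv s = (winv (scomp s (sgen i))).+2.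
Proof.
move=> des; have lin := ltn_ord i.
have pairK q : \sum_(p : 'I_n.*2.+1 * 'I_n.*2.+1) (p == q) = 1.
  by rewrite (bigD1 q) //= eqxx big1 // => p /negPf->.
pose g := gen_perm n i.
(* the flipped pairs; for s_0 the same pair is listed twice, as its weight
   is 2 *)
pose q2 := (rev_ord (pt n i.+1), if i == 0 :> nat then pt n i.+1 else rev_ord (pt n i)).
pose q1 := if i == 0 :> nat then q2 else (pt n i, pt n i.+1).
have gg : involutive g.
  move=> x; have /(congr1 (fun s => sgval s x)) := sgenK i.
  by rewrite scompE perm1.
have gK : involutive (fun p : 'I_n.*2.+1 * 'I_n.*2.+1 => (g p.1, g p.2)).
  by case=> a b /=; rewrite !gg.
have appg (x : 'I_n.*2.+1) : spval (scomp s (sgen i)) (g x) = spval s x.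
  by rewrite spval_scomp inord_val gg.
have pairE (a b c d : 'I_n.*2.+1) :
    ((a, b) == (c, d)) = (a == c :> nat) && (b == d :> nat) by [].
rewrite -addn2 -[2]/(1 + 1) -{1}(pairK q1) -(pairK q2) /winv.
rewrite [in RHS](reindex_inj (inv_inj gK)) addnA -!big_split /=.
apply: eq_bigr => p _; rewrite !appg.
case: p => a b /=.
have e1 : rev_ord (pt n i.+1) = n - i.+1 :> nat by rewrite val_rev_pt.
have e2 : rev_ord (pt n i) = n - i :> nat by rewrite val_rev_pt // ltnW.
have e3 : pt n i = n + i :> nat by rewrite val_pt // ltnW.
have e4 : pt n i.+1 = n + i.+1 :> nat by rewrite val_pt.
have rev1 : spval s (n - i.+1) = n.*2 - spval s (n + i.+1).
  by rewrite -spval_rev; [congr spval|]; lia.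
have rev2 : spval s (n - i) = n.*2 - spval s (n + i).
  by rewrite -spval_rev; [congr spval|]; lia.
have le1 := spval_le s (n + i.+1); have le2 := spval_le s (n + i).
rewrite /q1 /q2; case: (posnP i) => i0; cbv iota.
  rewrite !pairE e1 e4 {e1 e2 e3 e4 rev2 le2}.
  rewrite i0 addn0 addn1 subn1 spval_mid in des rev1 le1 *.
  have n0 : 0 < n by lia.
  have [] := swap0_nzlt n0 (gen_perm0 a n0) (gen_perm0 b n0).
  rewrite -i0 -/g /flip0; move: (nat_of_ord (g a)) (nat_of_ord (g b)).
  move: (nat_of_ord a) (nat_of_ord b) => {}a {}b ga gb + + + ->.
  case: (boolP ((a == n.-1) && (b == n.+1))) => [|_ _].
    case/andP=> /eqP-> /eqP-> /(_ isT)/andP[-> /negPf->] _ _.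
    rewrite rev1; lia.
  case: (boolP ((b == n.-1) && (a == n.+1))) => [|_ _].
    case/andP=> /eqP-> /eqP-> /(_ isT)/andP[-> /negPf->] _.
    rewrite rev1; lia.
  by move=> ->; rewrite ?addn0.
rewrite !pairE e1 e2 e3 e4.
have i0n : 0 < i < n by lia.
have [] := swapS_nzlt i0n (gen_permS a i0n) (gen_permS b i0n).
rewrite -/g /flipS; move: (nat_of_ord (g a)) (nat_of_ord (g b)).
move: (nat_of_ord a) (nat_of_ord b) => {}a {}b ga gb + + + ->.
case: (boolP (_ || _)) => [|/norP[/negPf-> /negPf->] _].
  move=> /[swap] /(_ isT)/andP[-> /negPf->] + _ _.
  by case/orP=> /andP[/eqP-> /eqP->]; rewrite ?rev1 ?rev2; lia.
case: (boolP (_ || _)) => [|_ _].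
  move=> /[swap] /(_ isT)/andP[-> /negPf->] + _.
  by case/orP=> /andP[/eqP-> /eqP->]; rewrite ?rev1 ?rev2; lia.
by move=> ->; rewrite ?addn0.
Qed.

Lemma winv1 : winv 1%g = 0.
Proof.
rewrite /winv big1 // => -[a b] _ /=.
by rewrite !spval_ord !perm1 /nzlt; case: (ltngtP a b); rewrite ?andbF.
Qed.

Lemma scomp_sgenK s (i : 'I_n) : scomp (scomp s (sgen i)) (sgen i) = s.
Proof. by have := sgenK i; rewrite /scomp mulgA => ->; rewrite mul1g. Qed.

Lemma spval_scomp_sgen s (i : 'I_n) :
  (spval (scomp s (sgen i)) (n + i.+1) < spval (scomp s (sgen i)) (n + i)) =
  (spval s (n + i) < spval s (n + i.+1)).
Proof.
have lin := ltn_ord i.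
have b1 : (inord (n + i) : 'I_n.*2.+1) = n + i :> nat by rewrite inordK //; lia.
have b2 : (inord (n + i.+1) : 'I_n.*2.+1) = n + i.+1 :> nat.
  by rewrite inordK //; lia.
rewrite !spval_scomp; case: (posnP i) => i0.
  rewrite i0 in b1 b2 lin *.
  have [] := gen_perm0 (inord (n + 0)) lin; rewrite b1; try lia.
  case=> _ _ ->; have [] := gen_perm0 (inord (n + 1)) lin; rewrite b2;
    [|lia|by rewrite addn1 eqxx; case].
  case=> _ ->; have := @spval_rev s n.+1; have := spval_le s n.+1.
  rewrite addn0 addn1 spval_mid; have -> : n.*2 - n.+1 = n.-1 by lia.
  lia.
have i0n : 0 < i < n by lia.
case: (gen_permS (inord (n + i)) i0n); rewrite b1; last by rewrite eqxx; case=> -[].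
case=> -[]; try lia; move=> _ ->.
case: (gen_permS (inord (n + i.+1)) i0n); rewrite b2; last by rewrite eqxx; case=> -[].
by case=> -[]; try lia; move=> _ ->.
Qed.

Lemma spval_neqS s (i : 'I_n) : spval s (n + i) != spval s (n + i.+1).
Proof.
have lin := ltn_ord i.
by apply/eqP => /spval_inj eq_app; have := eq_app; lia.
Qed.

(** A generator changes [winv] by at most 2, which bounds [winv] by twice the
length; conversely, going down along descents reaches the identity in
[winv s]/2 steps. *)
Lemma winv_slength s : winv s = (slength s).*2.
Proof.
have le_word w : winv (sgen_prod w) <= (size w).*2.
  elim/last_ind: w => [|w i IH]; first by rewrite winv1.
  rewrite sgen_prod_rcons size_rcons.
  have := spval_neqS (sgen_prod w) i; rewrite neq_ltn => /orP[asc|des].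
    rewrite (@winv_descent (scomp _ _) i) ?spval_scomp_sgen // scomp_sgenK.
    lia.
  have := winv_descent des; lia.
have [w ws wn] : exists2 w, sgen_prod w = s & (size w).*2 = winv s.
  have [m] := ubnP (winv s); elim: m s => // m IH s hm.
  case: (pickP (fun i : 'I_n => spval s (n + i.+1) < spval s (n + i))) => [i|nd].
    move=> des; have := winv_descent des => eq_w.
    have [|w ws wn] := IH (scomp s (sgen i)); first by lia.
    exists (rcons w i); rewrite ?sgen_prod_rcons ?ws ?scomp_sgenK //.
    by rewrite size_rcons eq_w -wn.
  exists [::]; last first.
    rewrite (_ : s = 1%g) ?winv1 //; apply: no_descent_id => i.
    by rewrite leqNgt; have := nd i; rewrite /spval /pt => ->.
  apply/esym/no_descent_id => i.
  by rewrite leqNgt; have := nd i; rewrite /spval /pt => ->.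
rewrite /slength; case: ex_minnP => k /existsP[v /eqP vs] min_k.
have := le_word v; rewrite vs size_tuple => le_k.
apply/eqP; rewrite eqn_leq le_k -wn leq_double.
by apply: min_k; apply/existsP; exists (in_tuple w); rewrite /= ws.
Qed.

Lemma in_Des s (i : 'I_n) : (i \in Des s) = (spval s (n + i.+1) < spval s (n + i)).
Proof.
have -> : (i \in Des s) = (winv (scomp s (sgen i)) < winv s).
  by rewrite in_set !winv_slength ltn_double.
have := spval_neqS s i; rewrite neq_ltn => /orP[asc|des].
  rewrite (@winv_descent (scomp _ _) i) ?spval_scomp_sgen // scomp_sgenK.
  by apply/idP/idP; lia.
by rewrite (winv_descent des) des; lia.
Qed.

End App.

(** * Inserting a point in a signed permutation *)

Section MkSigned.
Variable n : nat.

(** Made total by a default value, so that permutations can be given by formulas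
without carrying proofs; [mk_signedE] holds for all meaningful f. *)
Definition mk_signed (f : nat -> nat) : signed_perm n :=
  odflt 1%g [pick s : signed_perm n | [forall x : 'I_n.*2.+1, spval s x == f x]].

Lemma mk_signedE (f : nat -> nat) :
    (forall x, x <= n.*2 -> f x <= n.*2) ->
    (forall x y, x <= n.*2 -> y <= n.*2 -> f x = f y -> x = y) ->
    (forall x, x <= n.*2 -> f (n.*2 - x) = n.*2 - f x) ->
  forall x, x <= n.*2 -> spval (mk_signed f) x = f x.
Proof.
move=> f_le f_inj f_rev x xn; pose g (y : 'I_n.*2.+1) : 'I_n.*2.+1 := inord (f y).
have gE y : g y = f y :> nat by rewrite inordK // ltnS f_le // -ltnS.
have g_inj : injective g.
  move=> y z /(congr1 (@nat_of_ord _)); rewrite !gE => /f_inj eq_yz.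
  by apply/ord_inj/eq_yz; rewrite -ltnS.
have g_signed : perm g_inj \in signed_perm_set n.
  apply/signed_permP => y; apply: ord_inj.
  by rewrite !permE /= !gE /= !subSS f_rev // -ltnS.
rewrite /mk_signed; case: pickP => [s /forallP/(_ (inord x))/eqP | none].
  by rewrite inordK.
have /negP[] := none (Subg g_signed); apply/forallP => y.
by rewrite spval_ord /= permE gE.
Qed.
End MkSigned.

Section Gaps.
Variable n : nat.
Implicit Types V P x y : nat.

(** The points of rank n + 1 are the integers up to 2(n + 1), the zero being
n + 1.  Removing the points V and - V from them leaves a copy of the points of
rank n: [skip V] is the increasing embedding, [unskip V] its inverse. *)
Definition opp_pt V := n.+1.*2 - V.
Definition lowpt V := minn V (opp_pt V).
Definition skip V x := x + (lowpt V <= x) + (n.*2 < x + lowpt V).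
Definition unskip V y := y - (lowpt V < y) - (n.+1.*2 < y + lowpt V).
Definition nzpt V := (V <= n.+1.*2) && (V != n.+1).

Lemma lowptP V : nzpt V ->
  lowpt V <= n /\ (V = lowpt V /\ opp_pt V = n.+1.*2 - lowpt V \/
                   V = n.+1.*2 - lowpt V /\ opp_pt V = lowpt V).
Proof.
rewrite /nzpt /lowpt /opp_pt => /andP[Vn V1].
case: (leqP V (n.+1.*2 - V)) => h.
  by split; [lia | left].
by split; [lia | right; lia].
Qed.

Variables (V : nat) (V_nz : nzpt V).

Lemma skip_le x : x <= n.*2 -> skip V x <= n.+1.*2.
Proof.
rewrite /skip doubleS -addn2 -addnA => xn.
by rewrite leq_add // (leq_add (leq_b1 _) (leq_b1 _)).
Qed.

Lemma skip_neq x : (skip V x != V) && (skip V x != opp_pt V).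
Proof.
rewrite /skip; have [] := lowptP V_nz.
by move: (lowpt V) => L Ln [[-> ->]|[-> ->]];
  case: leqP => ?; case: ltnP => ?; rewrite /=; lia.
Qed.

Lemma skipK x : unskip V (skip V x) = x.
Proof.
rewrite /unskip /skip; have [+ _] := lowptP V_nz.
move: (lowpt V) => L Ln; case: (leqP L x) => ?; case: (ltnP n.*2) => ? /=;
  case: ltnP => ?; case: ltnP => ? /=; lia.
Qed.

Lemma unskipK y : y != V -> y != opp_pt V -> skip V (unskip V y) = y.
Proof.
have [lown eqV] := lowptP V_nz => y1 y2; rewrite /unskip /skip.
have [h1 h2] : y != lowpt V /\ y != n.+1.*2 - lowpt V by lia.
move: (lowpt V) lown h1 h2 => L ? h1 h2.
move ez: (y - _ - _) => z; move: ez.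
case: (ltnP L y) => ?; case: (ltnP n.+1.*2) => ? /= ez.
all: have [-> ->] : (L <= z) = (L < y) /\ (n.*2 < z + L) = (n.+1.*2 < y + L).
all: by [split; lia | lia].
Qed.

Lemma unskip_le y : y <= n.+1.*2 -> y != V -> y != opp_pt V ->
  unskip V y <= n.*2.
Proof.
have [lown eqV] := lowptP V_nz => yn y1 y2; rewrite /unskip.
have [h1 h2] : y != lowpt V /\ y != n.+1.*2 - lowpt V by lia.
by move: (lowpt V) lown h1 h2 => L ? ? ?;
  case: ltnP => ?; case: ltnP => ? /=; lia.
Qed.

Lemma skip_rev x : x <= n.*2 -> skip V (n.*2 - x) = n.+1.*2 - skip V x.
Proof.
rewrite /skip; have [+ _] := lowptP V_nz.
move: (lowpt V) => L Ln xn; case: leqP => ?; case: ltnP => ?;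
  case: leqP => ?; case: ltnP => ? /=; lia.
Qed.

Lemma unskip_rev y : y <= n.+1.*2 -> y != V -> y != opp_pt V ->
  unskip V (n.+1.*2 - y) = n.*2 - unskip V y.
Proof.
have [lown eqV] := lowptP V_nz => yn y1 y2; rewrite /unskip.
have [h1 h2] : y != lowpt V /\ y != n.+1.*2 - lowpt V by lia.
move: (lowpt V) lown h1 h2 => L ? h1 h2.
have -> : (L < n.+1.*2 - y) = ~~ (n.+1.*2 < y + L) by lia.
have -> : (n.+1.*2 < n.+1.*2 - y + L) = ~~ (L < y) by lia.
by case: (ltnP L y) => ?; case: (ltnP n.+1.*2) => ?; rewrite -!subnDA /=; lia.
Qed.

Lemma ltn_skip x y : (skip V x < skip V y) = (x < y).
Proof.
rewrite /skip; case: (leqP _ x) => ?; case: (ltnP _ (x + _)) => ?;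
  case: (leqP _ y) => ?; case: (ltnP _ (y + _)) => ? /=; lia.
Qed.

Lemma opp_ptK : opp_pt (opp_pt V) = V.
Proof. move: V_nz; rewrite /nzpt /opp_pt; lia. Qed.

Lemma opp_pt_nz : nzpt (opp_pt V).
Proof. move: V_nz; rewrite /nzpt /opp_pt; lia. Qed.

Lemma opp_pt_neq : opp_pt V != V.
Proof. move: V_nz; rewrite /nzpt /opp_pt; lia. Qed.
End Gaps.

Section Insert.
Variable n : nat.
Implicit Types (s : signed_perm n) (t : signed_perm n.+1) (V P x y : nat).

(** The signed permutation of rank n + 1 that sends V to P and induces s on the
remaining points. *)
Definition insert_at V P s : signed_perm n.+1 := mk_signed n.+1 (fun y =>
  if y == V then P else if y == opp_pt n V then opp_pt n P
  else skip n P (spval s (unskip n V y))).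

Lemma insert_atE V P s y : nzpt n V -> nzpt n P -> y <= n.+1.*2 ->
  spval (insert_at V P s) y = if y == V then P else if y == opp_pt n V then opp_pt n P
    else skip n P (spval s (unskip n V y)).
Proof.
move=> Vz Pz; move: y; apply: mk_signedE => [y yn|y z yn zn|y yn].
- have [Pn _] := andP Pz; case: ifP => // _; case: ifP => _.
    by rewrite leq_subr.
  by rewrite skip_le ?spval_le.
- have sk x := negPf (proj1 (andP (skip_neq Pz x))).
  have sk' x := negPf (proj2 (andP (skip_neq Pz x))).
  have oP := negPf (opp_pt_neq Pz).
  case: (y =P V) => [->|/eqP y1]; case: (z =P V) => [->|/eqP z1] //.
  + by case: eqP => _ /esym/eqP; rewrite ?oP ?sk.
  + by case: eqP => _ /eqP; rewrite ?oP ?sk.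
  case: (y =P _) => [->|/eqP y2]; case: (z =P _) => [->|/eqP z2] //.
  + by move/esym/eqP; rewrite sk'.
  + by move/eqP; rewrite sk'.
  move/(congr1 (unskip n P)); rewrite !skipK // => /spval_inj.
  rewrite !unskip_le // => /(_ isT isT)/(congr1 (skip n V)).
  by rewrite !unskipK.
- have e1 : (n.+1.*2 - y == V) = (y == opp_pt n V).
    by move: Vz; rewrite /nzpt /opp_pt; lia.
  have e2 : (n.+1.*2 - y == opp_pt n V) = (y == V).
    by move: Vz; rewrite /nzpt /opp_pt; lia.
  rewrite e1 e2; case: (y =P V) => [->|/eqP y1].
    by rewrite eq_sym (negPf (opp_pt_neq Vz)).
  case: eqP => [_|/eqP y2]; first by rewrite -/(opp_pt n _) opp_ptK.
  by rewrite unskip_rev // spval_rev ?unskip_le // skip_rev ?spval_le.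
Qed.

Definition delete_at V P t : signed_perm n :=
  mk_signed n (fun x => unskip n P (spval t (skip n V x))).

Lemma delete_atE V P t x : nzpt n V -> nzpt n P -> spval t V = P -> x <= n.*2 ->
  spval (delete_at V P t) x = unskip n P (spval t (skip n V x)).
Proof.
move=> Vz Pz tV; have Vn := proj1 (andP Vz).
have tV' : spval t (opp_pt n V) = opp_pt n P by rewrite spval_rev // tV.
have sk z : z <= n.*2 -> skip n V z <= n.+1.*2 by apply: skip_le.
have neq z : z <= n.*2 ->
    (spval t (skip n V z) != P) && (spval t (skip n V z) != opp_pt n P).
  move=> zn; have := skip_neq Vz z; rewrite -tV' -tV.
  by case/andP=> n1 n2; apply/andP; split;
     [apply: contra n1|apply: contra n2] => /eqP/spval_inj->; rewrite ?sk ?leq_subr.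
move: x; apply: mk_signedE => [x xn|x y xn yn|x xn].
- by have /andP[? ?] := neq x xn; rewrite unskip_le ?spval_le.
- have /andP[? ?] := neq x xn; have /andP[? ?] := neq y yn.
  move/(congr1 (skip n P)); rewrite !unskipK // => /spval_inj.
  by rewrite !sk // => /(_ isT isT)/(congr1 (unskip n V)); rewrite !skipK.
- have /andP[? ?] := neq x xn.
  by rewrite skip_rev // spval_rev ?sk // unskip_rev ?spval_le.
Qed.

Lemma insert_at_pt V P s : nzpt n V -> nzpt n P -> spval (insert_at V P s) V = P.
Proof. by move=> Vz Pz; rewrite insert_atE ?eqxx //; case/andP: Vz. Qed.

Lemma insert_at_skip V P s x : nzpt n V -> nzpt n P -> x <= n.*2 ->
  spval (insert_at V P s) (skip n V x) = skip n P (spval s x).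
Proof.
move=> Vz Pz xn; rewrite insert_atE ?skip_le //.
by have /andP[/negPf-> /negPf->] := skip_neq Vz x; rewrite skipK.
Qed.

Lemma insert_atK V P s : nzpt n V -> nzpt n P -> delete_at V P (insert_at V P s) = s.
Proof.
move=> Vz Pz; apply: spval_ext => x xn.
by rewrite delete_atE ?insert_at_pt // insert_at_skip // skipK.
Qed.

Lemma delete_atK V P t : nzpt n V -> nzpt n P -> spval t V = P ->
  insert_at V P (delete_at V P t) = t.
Proof.
move=> Vz Pz tV; apply: spval_ext => y yn; have Vn := proj1 (andP Vz).
have tV' : spval t (opp_pt n V) = opp_pt n P by rewrite spval_rev // tV.
rewrite insert_atE //; case: eqP => [->//|/eqP y1]; case: eqP => [->//|/eqP y2].
rewrite delete_atE ?unskip_le // unskipK // unskipK // -?tV' -?tV.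
  by apply: contra y1 => /eqP/spval_inj->.
by apply: contra y2 => /eqP/spval_inj->; rewrite ?leq_subr.
Qed.

Lemma insert_atV V P s : nzpt n V -> nzpt n P -> (insert_at V P s)^-1%g = insert_at P V s^-1%g.
Proof.
move=> Vz Pz; apply: spval_ext => y yn; set t := insert_at V P s.
suff {1}<- : spval t (spval (insert_at P V s^-1%g) y) = y by rewrite spval_invK ?spval_le.
have tV : spval t V = P by apply: insert_at_pt.
have [Vn _] := andP Vz.
rewrite insert_atE //; case: eqP => [->//|/eqP y1]; case: eqP => [->|/eqP y2].
  by rewrite spval_rev // tV.
by rewrite insert_at_skip ?spval_le // spval_Kinv ?unskip_le // unskipK.
Qed.

(** For fixed V and P, insertion is a bijection from the signed permutations of
rank n to those of rank n + 1 that send V to P. *)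
Lemma big_insert_at (R : Type) (idx : R) (op : Monoid.com_law idx) V P
    (F : signed_perm n.+1 -> R) : nzpt n V -> nzpt n P ->
  \big[op/idx]_(t | spval t V == P) F t = \big[op/idx]_s F (insert_at V P s).
Proof.
move=> Vz Pz; rewrite (reindex_onto (insert_at V P) (delete_at V P)).
  by apply: eq_bigl => s; rewrite insert_at_pt // insert_atK // !eqxx.
by move=> t /eqP; apply: delete_atK.
Qed.

Lemma leq_double_card : #|{: signed_perm n}|.*2 <= #|{: signed_perm n.+1}|.
Proof.
have Vz : nzpt n 0 by [].
have Pz : nzpt n n.+1.*2 by rewrite /nzpt leqnn; lia.
have cardE P : nzpt n P ->
    \sum_(t : signed_perm n.+1 | spval t 0 == P) 1 = #|{: signed_perm n}|.
  by move=> /(big_insert_at _ _ Vz)->; rewrite sum1_card.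
rewrite -[X in _ <= X]sum1_card (bigID (fun t : signed_perm n.+1 => spval t 0 == 0)) /=.
rewrite cardE // -addnn leq_add2l -(cardE _ Pz) [X in _ <= X]big_mkcond.
rewrite [X in X <= _]big_mkcond; apply: leq_sum => t _.
by case: eqP => // ->.
Qed.

(** Positions beyond the last one count as descents.  The path of the descents
thus has a virtual last edge, which makes an insertion at the end of the path
obey the same formulas as the others. *)
Definition dsc m (s : signed_perm m) (i : nat) : bool :=
  (i < m) ==> (spval s (m + i.+1) < spval s (m + i)).

(** The points other than n + 1 = 0 that can be inserted correspond to the
2n + 2 gaps of the points of rank n, the gap g lying just below the point g;
the new point of the gap g is [bump n.+1 g]. *)
Lemma ltn_skip_bump g y : g < n.+1.*2 ->
  (skip n (bump n.+1 g) y < bump n.+1 g) = (y < g).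
Proof.
rewrite /skip /lowpt /opp_pt /bump => gn; case: (ltnP n g) => ng /=.
  rewrite (minn_idPr _); last by lia.
  by case: (leqP _ y) => ?; case: (ltnP n.*2) => ? /=; lia.
rewrite (minn_idPl _); last by lia.
by case: (leqP _ y) => ?; case: (ltnP n.*2) => ? /=; lia.
Qed.

Lemma bump_nz g : g < n.+1.*2 -> nzpt n (bump n.+1 g).
Proof. by move=> gn; rewrite /nzpt eq_sym neq_bump andbT /bump; lia. Qed.

Lemma skip_pos j i : j <= n -> skip n (n.+1 + j.+1) (n + i) = n.+1 + i + (j < i).
Proof.
move=> jn; rewrite /skip /lowpt /opp_pt (minn_idPr _); last by lia.
by case: leqP => ?; case: ltnP => ?; case: ltnP => ? /=; lia.
Qed.

(** Inserting a point at a positive argument replaces the edge j of the descent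
path by the edges j and j + 1 around the new point. *)
Lemma dsc_insert_at j g s i : j <= n -> g < n.+1.*2 ->
  dsc (insert_at (n.+1 + j.+1) (bump n.+1 g) s) i =
  if i < j then dsc s i else if i == j then g <= spval s (n + j)
  else if i == j.+1 then (j < n) ==> (spval s (n + j.+1) < g) else dsc s i.-1.
Proof.
move=> jn gn; set V := n.+1 + j.+1; set P := bump n.+1 g.
have Pz : nzpt n P by apply: bump_nz.
have Vz : nzpt n V by rewrite /nzpt /V; lia.
have low k : k <= j -> spval (insert_at V P s) (n.+1 + k) = skip n P (spval s (n + k)).
  move=> kj; have -> : n.+1 + k = skip n V (n + k).
    by rewrite skip_pos // ltnNge kj addn0.
  by rewrite insert_at_skip //; lia.
have high k : j < k -> k <= n ->
    spval (insert_at V P s) (n.+1 + k.+1) = skip n P (spval s (n + k)).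
  move=> jk kn; have -> : n.+1 + k.+1 = skip n V (n + k).
    by rewrite skip_pos // jk addn1 addnS.
  by rewrite insert_at_skip //; lia.
rewrite /dsc; case: (ltngtP i j) => [ij|ji|->].
- have lin := leq_trans ij jn.
  by rewrite !low ?ltn_skip // ?lin ?ltnS ?(ltnW lin) // ltnW.
- case: eqP => [->|/eqP ij1].
    rewrite ltnS; case: ltnP => //= jn'.
    by rewrite high // insert_at_pt // ltn_skip_bump.
  case: i ji ij1 => // i ji ij1; rewrite ltnS /=; case: ltnP => //= lin.
  by rewrite !high ?ltn_skip //; lia.
- rewrite ltnS jn /= insert_at_pt // low // ltnNge.
  rewrite leq_eqVlt negb_or ltn_skip_bump // -leqNgt.
  by have /andP[-> _] := skip_neq Pz (spval s (n + j)).
Qed.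

Lemma dsc_insert_at_bump j g s i : j <= n -> g < n.+1.*2 -> i != j ->
  dsc (insert_at (n.+1 + j.+1) (bump n.+1 g) s) (bump j.+1 i) = dsc s i.
Proof.
move=> jn gn; rewrite dsc_insert_at // /bump; case: (ltngtP i j) => // [ij|ji] _.
  by rewrite add0n ij.
have [-> -> ->] :
    [/\ true + i < j = false, true + i == j = false & true + i == j.+1 = false].
  by split; lia.
by [].
Qed.
End Insert.

(** * Subsets as cuts of a path *)

Lemma big_andE_ord N (p : 'I_N -> bool) :
  \big[andb/true]_(i < N) p i = [forall i : 'I_N, p i].
Proof. by rewrite big_andE; apply: eq_forallb => i. Qed.

Section Bits.
Variable n : nat.
Implicit Types (T U : {set 'I_n}).

(** Indices beyond n - 1 belong to T by convention: the end of the path is a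
cut.  This matches the convention on [dsc]. *)
Definition bit T (i : nat) := [forall j : 'I_n, (j == i :> nat) ==> (j \in T)].

Lemma bit_ord T (j : 'I_n) : bit T j = (j \in T).
Proof.
apply/forallP/idP => [/(_ j)|jT k]; first by rewrite eqxx.
by apply/implyP => /eqP/ord_inj->.
Qed.

Lemma bit_out T i : n <= i -> bit T i.
Proof. by move=> ni; apply/forallP => j; rewrite ltn_eqF // (leq_trans _ ni). Qed.

Definition setb (b : nat -> bool) : {set 'I_n} := [set j : 'I_n | b j].

Lemma bit_setb b i : bit (setb b) i = (n <= i) || b i.
Proof.
case: leqP => [/bit_out->//|lin].
by have := bit_ord (setb b) (Ordinal lin); rewrite inE.
Qed.

Lemma bit_inj T U : (forall i, i < n -> bit T i = bit U i) -> T = U.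
Proof. by move=> eqTU; apply/setP => j; rewrite -!bit_ord eqTU. Qed.

Lemma Des_sub (s : signed_perm n) T N : n <= N ->
  (Des s \subset T) = \big[andb/true]_(i < N) (dsc s i ==> bit T i).
Proof.
move=> nN; rewrite big_andE_ord; apply/subsetP/forallP => [sub i|all i].
  apply/implyP => di; case: (ltnP i n) => [lin|/bit_out->//].
  have := sub (Ordinal lin); rewrite in_Des -bit_ord; apply.
  by move: di; rewrite /dsc lin.
rewrite in_Des -bit_ord => di; apply: (implyP (all (widen_ord nN i))).
by rewrite /dsc /= ltn_ord.
Qed.

Lemma setC_sub_Des (s : signed_perm n) T N : n <= N ->
  (~: T \subset Des s) = \big[andb/true]_(i < N) (bit T i || dsc s i).
Proof.
move=> nN; rewrite big_andE_ord; apply/subsetP/forallP => [sub i|all i].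
  case: (ltnP i n) => [lin|/bit_out->//]; rewrite -implyNb; apply/implyP => ti.
  have := sub (Ordinal lin); rewrite in_Des inE -bit_ord /dsc lin; exact.
rewrite in_Des inE -bit_ord => ti; have := all (widen_ord nN i).
by rewrite /= (negPf ti) /dsc ltn_ord.
Qed.
End Bits.

(** Separates the edges v and v + 1 around the vertex v + 1; the other edges are
numbered as in the path where this vertex has been removed. *)
Lemma big_split_edge (R : Type) (idx : R) (op : Monoid.com_law idx) n v
    (F : nat -> R) : v <= n ->
  \big[op/idx]_(i < n.+2) F i =
  op (op (F v) (F v.+1)) (\big[op/idx]_(j < n.+1 | j != v :> nat) F (bump v.+1 j)).
Proof.
move=> vn; have v2 : v.+1 < n.+2 by [].
have v1 : v < n.+1 by [].
rewrite (bigD1_ord (Ordinal v2)) //= (bigD1 (Ordinal v1)) //=.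
by rewrite /bump ltnn add0n Monoid.mulmCA Monoid.mulmA.
Qed.

Section Merge.
Variable n : nat.

(** The removal of the vertex v + 1 of the path: the edges v and v + 1 become
one, which is a cut if one of them was. *)
Definition merge_edges v (T : {set 'I_n.+1}) : {set 'I_n} :=
  setb n (fun i => if i < v then bit T i
                   else if i == v then bit T v || bit T v.+1 else bit T i.+1).

Lemma bit_merge_edges v T i : v <= n -> bit (merge_edges v T) i =
  if i < v then bit T i else if i == v then bit T v || bit T v.+1 else bit T i.+1.
Proof.
move=> vn; rewrite bit_setb; case: (leqP n i) => //= ni.
rewrite ltnNge (leq_trans vn ni) /=; case: eqP => [<-|_].
  by rewrite [bit T i.+1]bit_out ?orbT.
by rewrite bit_out.
Qed.

Lemma bit_merge_edges_bump v T j : v <= n -> j != v ->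
  bit T (bump v.+1 j) = bit (merge_edges v T) j.
Proof.
move=> vn jv; rewrite bit_merge_edges // /bump (negPf jv).
by case: (ltngtP j v) jv => //; rewrite add1n.
Qed.

Definition split_edges v a b (T : {set 'I_n}) : {set 'I_n.+1} :=
  setb n.+1 (fun i => if i < v then bit T i else if i == v then a
                      else if i == v.+1 then b else bit T i.-1).

Lemma bit_split_edges v a b T : v <= n ->
  (bit (split_edges v a b T) v = a) * (bit (split_edges v a b T) v.+1 = (v == n) || b).
Proof.
move=> vn; split; rewrite bit_setb.
  by rewrite ltnn eqxx ltnNge vn.
by rewrite ltnS [v.+1 < v]ltnNge leqnSn gtn_eqF // eqxx eqn_leq vn.
Qed.

Lemma bit_split_edges_bump v a b T j : v <= n -> j != v ->
  bit (split_edges v a b T) (bump v.+1 j) = bit T j.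
Proof.
move=> vn jv; rewrite bit_setb /bump; case: (ltngtP j v) jv => // [jv|vj] _.
  by rewrite add0n jv ltnNge (leq_trans (ltnW jv) vn).
rewrite add1n ltnS; case: (leqP n j) => [/bit_out->//|_].
have [-> -> ->] : [/\ j.+1 < v = false, j.+1 == v = false & j.+1 == v.+1 = false].
  by split; lia.
by [].
Qed.

Lemma merge_edgesK v a b T : v <= n -> bit T v = a || b ->
  merge_edges v (split_edges v a b T) = T.
Proof.
move=> vn ab; apply: bit_inj => i lin; rewrite bit_merge_edges // !bit_split_edges //.
rewrite !bit_setb !ltnS !(leqNgt n) lin.
case: (ltngtP i v) => [iv|vi|eq_i].
- by rewrite ltnNge (ltnW lin).
- have [-> -> ->] : [/\ i.+1 < v = false, i.+1 == v = false & i.+1 == v.+1 = false].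
    by split; lia.
  by [].
- by rewrite eq_i in lin *; rewrite (ltn_eqF lin) ab.
Qed.

Lemma split_edgesK v T : v <= n -> split_edges v (bit T v) (bit T v.+1) (merge_edges v T) = T.
Proof.
move=> vn; apply: bit_inj => i lin; rewrite bit_setb leqNgt lin /= bit_merge_edges //.
case: (ltngtP i v) => [iv|vi|->] //; case: eqP => [->//|/eqP iv].
case: i vi iv {lin} => // i; rewrite ltnS eqSS /= => vi iv.
by rewrite bit_merge_edges // ltnNge vi /= (negPf iv).
Qed.

Local Open Scope ring_scope.

(** Only the bits v and v + 1 of U are not determined by [merge_edges v U], and
their disjunction is; for v = n the bit v + 1 is the conventional one. *)
Lemma sum_merge_edges (v : nat) (T : {set 'I_n}) (F : {set 'I_n.+1} -> rat) : (v <= n)%N ->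
  \sum_(U | merge_edges v U == T) F U =
  \sum_(ab : bool * bool | (bit T v == ab.1 || ab.2) && ((v == n) ==> ab.2))
    F (split_edges v ab.1 ab.2 T).
Proof.
move=> vn; rewrite (reindex_onto (fun ab => split_edges v ab.1 ab.2 T)
   (fun U => (bit U v, bit U v.+1))) => [|U /eqP <-]; last exact: split_edgesK.
apply: eq_bigl => -[a b] /=; rewrite !bit_split_edges //.
apply/andP/andP => [[/eqP <- /eqP[]]|[/eqP ab vb]].
  rewrite bit_merge_edges // !bit_split_edges // ltnn eqxx.
  by case: (v == n) => //= <-; rewrite ?orbT.
rewrite merge_edgesK // eqxx; split=> //; apply/eqP; congr (_, _).
by case: eqP vb => //= _ ->.
Qed.
End Merge.

(** * Reduction to subsets, and the derivation *)

Section Entries.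
Variable n : nat.
Local Open Scope ring_scope.
Implicit Types (s t : signed_perm n) (T U : {set 'I_n}).

(** The entries of the factors Y and X of AdjB, and of the matrix R = X Y. *)
Definition des_in s U : rat := (Des s \subset U)%:R.
Definition alt_desV T t : rat := (-1) ^+ #|~: T| * (~: T \subset Des t^-1%g)%:R.
Definition reduced_adj T U : rat := \sum_s alt_desV T s * des_in s U.

Lemma subset_prod (I : finType) (A B : {set I}) :
  (A \subset B)%:R = \prod_i ((i \in A) ==> (i \in B))%:R :> rat.
Proof.
have natrB : {morph (fun b : bool => b%:R : rat) : b c / b && c >-> b * c}.
  by move=> b c; rewrite -natrM mulnb.
rewrite -(big_morph _ natrB (id2 := true) (erefl _)) big_andE.
congr (nat_of_bool _)%:R; apply/subsetP/forallP => h i.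
  by apply/implyP => _; apply/implyP/h.
exact/implyP/(implyP (h i)).
Qed.

Lemma signr_card (I : finType) (A : {set I}) :
  (-1) ^+ #|A| = \prod_i (-1) ^+ (i \in A) :> rat.
Proof. by rewrite -prodr_const big_mkcond; apply: eq_bigr => i _; case: ifP. Qed.

(** Expands the product over i of 1 - [i \in B and i \notin A], which is the
indicator of B \subset A. *)
Lemma sum_alternating_subset (I : finType) (A B : {set I}) :
  \sum_(U : {set I}) (A \subset U)%:R * ((-1) ^+ #|~: U| * (~: U \subset B)%:R) =
  (B \subset A)%:R :> rat.
Proof.
pose G i : rat := - ((i \in B) && (i \notin A))%:R.
transitivity (\sum_(U : {set I}) \prod_i (if i \in U then 1 else G i)).
  apply: eq_bigr => U _; rewrite !subset_prod signr_card -!big_split.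
  apply: eq_bigr => i _; rewrite /G in_setC.
  by case: (i \in U); case: (i \in A); case: (i \in B);
    rewrite !(mulr0, mulr1, mul0r, mul1r, oppr0, expr0, expr1).
rewrite -bigA_distr subset_prod; apply: eq_bigr => i _; rewrite /G.
by case: (i \in A); case: (i \in B); rewrite ?(addr0, oppr0, addrN).
Qed.

Lemma sum_des_in_alt_desV s t :
  \sum_U des_in s U * alt_desV U t = (Des t^-1%g \subset Des s)%:R.
Proof. exact: sum_alternating_subset. Qed.

Definition bit_sign (b : nat -> bool) (N : nat) : rat := \prod_(i < N) (-1) ^+ (~~ b i).

Lemma signr_bit T N : (n <= N)%N -> (-1) ^+ #|~: T| = bit_sign (bit T) N.
Proof.
move=> nN; rewrite signr_card /bit_sign.
rewrite -(big_mkord xpredT (fun i => (-1) ^+ (~~ bit T i))) (@big_cat_nat _ _ _ n) //=.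
rewrite big_mkord [X in _ * X]big_nat_cond [X in _ * X]big1 ?mulr1.
  by apply: eq_bigr => i _; rewrite bit_ord inE.
by move=> i /andP[/andP[ni _] _]; rewrite bit_out.
Qed.
End Entries.

Section Intertwine.
Variable n : nat.
Local Open Scope ring_scope.

(** The derivation D.  Removing a vertex of a block of size at least 2 merges an
edge that is not a cut; removing a block reduced to one vertex merges two cuts
and gets the sign -1. *)
Definition contraction (T : {set 'I_n.+1}) (U : {set 'I_n}) : rat :=
  \sum_(v < n.+1) (-1) ^+ (bit T v && bit T v.+1) * (merge_edges v T == U)%:R.

Lemma sum_contraction (f : {set 'I_n} -> rat) (T : {set 'I_n.+1}) :
  \sum_U contraction T U * f U =
  \sum_(v < n.+1) (-1) ^+ (bit T v && bit T v.+1) * f (merge_edges v T).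
Proof.
under eq_bigr do rewrite /contraction mulr_suml.
rewrite exchange_big; apply: eq_bigr => q _.
rewrite (bigD1 (merge_edges q T)) //= big1 ?addr0 => [|W /negPf nW].
  by rewrite eqxx mulr1.
by rewrite eq_sym nW mulr0 mul0r.
Qed.

(** The first factor restricts g to an interval from lo to hi, with L lo false
and L hi true; lo and hi are 0 and N where a and b lift the constraints. *)
Lemma telescope_window (N y0 y1 : nat) (a b : bool) (L : nat -> bool) :
    (y0 < N)%N -> (y1 < N)%N ->
    ~~ L 0%N -> L N -> (~~ a -> L y0.+1) -> (~~ b -> ~~ L y1.+1) ->
  \sum_(g < N) ((a || (g <= y0)%N) && (b || (y1 < g)%N))%:R *
    ((L g)%:R - (L g.+1)%:R) = - (a || b || (y1 < y0)%N)%:R :> rat.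
Proof.
move=> y0N y1N L0 LN La Lb.
pose lo := (if b then 0 else y1.+1)%N; pose hi := (if a then N else y0.+1)%N.
have Llo : L lo = false by apply/negbTE; rewrite /lo; case: (b) Lb => // ->.
have Lhi : L hi by rewrite /hi; case: (a) La => // ->.
have hiN : (hi <= N)%N by rewrite /hi; case: (a).
transitivity (\sum_(0 <= g < N | (lo <= g < hi)%N) ((L g)%:R - (L g.+1)%:R) : rat).
  rewrite big_mkord [RHS]big_mkcond; apply: eq_bigr => g _.
  have -> : (lo <= g < hi)%N = (a || (g <= y0)%N) && (b || (y1 < g)%N).
    by rewrite andbC /lo /hi; case: (a); case: (b); rewrite ?ltn_ord.
  by case: (_ && _); rewrite ?mul1r ?mul0r.
(* L separates y1 + 1 from N *)
have y1N' : ~~ b -> (y1.+1 < N)%N.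
  move=> /Lb; rewrite ltn_neqAle y1N andbT; apply: contraNneq => ->.
  exact: LN.
have -> : (a || b || (y1 < y0)%N) = (lo < hi)%N.
  have N0 := leq_ltn_trans (leq0n _) y0N.
  by rewrite /lo /hi; case: (a); case: (b) y1N' => //= ->.
case: (ltnP lo hi) => [lohi|hilo]; last first.
  rewrite big_nat_cond big1 ?oppr0 // => g /andP[_ /andP[h1 h2]].
  by have := leq_trans (leq_ltn_trans h1 h2) hilo; rewrite ltnn.
transitivity (\sum_(lo <= g < hi) ((L g)%:R - (L g.+1)%:R) : rat).
  rewrite [RHS](big_nat_widenl _ 0%N) // [RHS](big_nat_widen _ _ _ _ _ hiN).
  by apply: eq_bigl => g; rewrite andTb.
rewrite (telescope_sumr_eq (fun g => - (L g)%:R)) ?(ltnW lohi) //.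
  by rewrite Llo Lhi oppr0 subr0.
by move=> g _; rewrite opprK addrC.
Qed.

(** If the merged edge is not a cut, neither of the two edges is, and none of
them may be a descent.  If it is a cut, then one of the two edges is a cut and
the other may not be a descent, or both are cuts and the term has the sign
-1. *)
Lemma sum_des_in_merge (t : signed_perm n.+1) (v : nat) (U' : {set 'I_n}) : (v <= n)%N ->
  \sum_U des_in t U * ((-1) ^+ (bit U v && bit U v.+1) * (merge_edges v U == U')%:R) =
  (\big[andb/true]_(j < n.+1 | j != v :> nat) (dsc t (bump v.+1 j) ==> bit U' j))%:R *
  (if bit U' v then (~~ dsc t v)%:R + (~~ dsc t v.+1)%:R - 1
   else (~~ dsc t v && ~~ dsc t v.+1)%:R).
Proof.
move=> vn; rewrite (bigID (fun U => merge_edges v U == U')) /= addrC big1 => [|U /negPf->];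
  last by rewrite !mulr0.
rewrite add0r (eq_bigr (fun U => des_in t U * (-1) ^+ (bit U v && bit U v.+1))) =>
  [|U ->]; last by rewrite mulr1.
rewrite sum_merge_edges //.
set r := \big[andb/true]_(j < _ | _) _.
have des_inE a b : (v == n) ==> b ->
    des_in t (split_edges v a b U') =
    (r && ((dsc t v ==> a) && (dsc t v.+1 ==> b)))%:R.
  move=> vb; rewrite /des_in (@Des_sub _ _ _ n.+2) //.
  rewrite (big_split_edge _
    (fun i => dsc t i ==> bit (split_edges v a b U') i) vn) /=.
  rewrite !bit_split_edges // andbC; congr (_ && (_ && _))%:R.
    by apply: eq_bigr => j jv; rewrite bit_split_edges_bump.
  by case: eqP vb => //= _ ->.
have dn : v = n -> dsc t v.+1 by move->; rewrite /dsc ltnn.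
transitivity (\sum_(ab : bool * bool | bit U' v == ab.1 || ab.2)
   (r && ((dsc t v ==> ab.1) && (dsc t v.+1 ==> ab.2)))%:R * (-1) ^+ (ab.1 && ab.2) : rat).
  rewrite big_mkcondr; apply: eq_bigr => -[a b] /= ab.
  case: ifP => [vb|]; last by case: eqP => // /dn -> ->; rewrite /= !andbF mul0r.
  rewrite des_inE // !bit_split_edges //.
  by case: eqP vb => //= _ ->.
rewrite big_mkcond -(pair_bigA _ (fun a b => if bit U' v == a || b then
   (r && ((dsc t v ==> a) && (dsc t v.+1 ==> b)))%:R * (-1) ^+ (a && b) else 0)).
rewrite /= !big_bool /=.
by case: (bit U' v); case: (r); case: (dsc t v); case: (dsc t v.+1) => /=; ring.
Qed.
End Intertwine.

(** * The telescoping identity *)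

Section Gap.
Variable n : nat.
Implicit Types (s : signed_perm n).

Lemma lowpt_opp V : nzpt n V -> lowpt n (opp_pt n V) = lowpt n V.
Proof. by move=> Vz; rewrite /lowpt (opp_ptK Vz) minnC. Qed.

(** A signed permutation that sends V to P sends - V to - P. *)
Lemma insert_at_opp V P s : nzpt n V -> nzpt n P ->
  insert_at (opp_pt n V) (opp_pt n P) s = insert_at V P s.
Proof.
move=> Vz Pz; apply: spval_ext => y yn; rewrite !insert_atE ?opp_pt_nz //.
rewrite !opp_ptK // /skip /unskip !lowpt_opp //.
case: (y =P V) => [->|//]; rewrite eq_sym; case: eqP => // eqV.
by have := opp_pt_neq Vz; rewrite eqV eqxx.
Qed.

(** The new point of the gap g is v + 1 or - (v + 1), for v = [gap_vertex g]. *)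
Definition gap_vertex g := if g <= n then n - g else g - n.+1.

(** The function L of the telescoping sum: the point just below the gap g has
its image below the new image q + 1.  It is false below all points and true
above all points. *)
Definition before s q g := (0 < g) && ((n.*2 < g.-1) || (spval s g.-1 <= n + q)).

Lemma gap_vertex_le g : g < n.+1.*2 -> gap_vertex g <= n.
Proof. by rewrite /gap_vertex; case: ifP; lia. Qed.

(** The two edges around the new point compare its image with those of its two
neighbours; their roles are exchanged when the new point is negative, as the
descents are read on the opposite points.  If the old edge between the
neighbours is not a descent then L is monotone across the gap, else it is
monotone in the other direction. *)
Lemma dsc_gap s g q (v := gap_vertex g) (t := insert_at (bump n.+1 g) (n.+1 + q.+1) s) :
    g < n.+1.*2 -> q <= n ->
  [/\ (forall j, j != v -> dsc t (bump v.+1 j) = dsc s j),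
      (dsc t v = ~~ before s q g /\ dsc t v.+1 = before s q g.+1) \/
      (dsc t v.+1 = ~~ before s q g /\ dsc t v = before s q g.+1) &
      v < n -> if dsc s v then before s q g -> before s q g.+1
                          else before s q g.+1 -> before s q g].
Proof.
move=> gn qn; have vn : v <= n := gap_vertex_le gn.
have qE : n.+1 + q.+1 = bump n.+1 (n + q.+1) by rewrite /bump; lia.
have tn : bump n.+1 g <= n.+1.*2 by have /andP[] := bump_nz gn.
have Pz : nzpt n (n.+1 + q.+1) by rewrite qE bump_nz //; lia.
case: (leqP g n) => gn'.
  have vE : v = n - g by rewrite /v /gap_vertex gn'.
  have tE : t = insert_at (n.+1 + v.+1) (bump n.+1 (n - q)) s.
    rewrite /t -insert_at_opp ?bump_nz //; congr (insert_at _ _ _).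
      by rewrite /opp_pt /bump vE; lia.
    by rewrite /opp_pt /bump; lia.
  have Pn : n - q < n.+1.*2 by lia.
  have dv : dsc t v = before s q g.+1.
    rewrite tE dsc_insert_at // ltnn eqxx /before /=.
    have := @spval_rev n s g; have := spval_le s g.
    have -> : n.*2 - g = n + v by lia.
    by rewrite ltnNge; lia.
  have dv1 : dsc t v.+1 = ~~ before s q g.
    rewrite tE dsc_insert_at // ltnNge leqnSn gtn_eqF // eqxx /before.
    case: (posnP g) => g0; first by rewrite vE g0 subn0 ltnn.
    have := @spval_rev n s g.-1; have := spval_le s g.-1.
    have -> : n.*2 - g.-1 = n + v.+1 by lia.
    have -> : v < n by lia.
    by rewrite implyTb /=; lia.
  split; [by move=> j jv; rewrite tE dsc_insert_at_bump | by right |] => vn'.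
  rewrite /dsc vn' implyTb /before.
  have := @spval_rev n s g.-1; have := spval_le s g.-1.
  have := @spval_rev n s g; have := spval_le s g.
  have -> : n.*2 - g.-1 = n + v.+1 by lia.
  have -> : n.*2 - g = n + v by lia.
  by case: ltnP; rewrite /=; lia.
have vE : v = g - n.+1 by rewrite /v /gap_vertex leqNgt gn'.
have gE : bump n.+1 g = n.+1 + v.+1 by rewrite /bump; lia.
have tE : t = insert_at (n.+1 + v.+1) (bump n.+1 (n + q.+1)) s.
  by rewrite /t gE qE.
have Pn : n + q.+1 < n.+1.*2 by lia.
have dv : dsc t v = ~~ before s q g.
  rewrite tE dsc_insert_at // ltnn eqxx /before.
  have -> : g.-1 = n + v by lia.
  lia.
have dv1 : dsc t v.+1 = before s q g.+1.
  rewrite tE dsc_insert_at // ltnNge leqnSn gtn_eqF // eqxx /before /=.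
  have -> : g = n + v.+1 by lia.
  have -> : (n.*2 < n + v.+1) = ~~ (v < n) by lia.
  by rewrite /= [n + q.+1]addnS ltnS implybE.
split; [by move=> j jv; rewrite tE dsc_insert_at_bump | by left |] => vn'.
rewrite /dsc vn' implyTb /before /=.
have -> : g.-1 = n + v by lia.
have -> : g = n + v.+1 by lia.
by case: ltnP; lia.
Qed.
End Gap.

Section GapSums.
Variable n : nat.
Local Open Scope ring_scope.
Implicit Types (s : signed_perm n) (t : signed_perm n.+1).

(** A sum over the vertices v + 1 is a sum over their images up to sign: exactly
one of v + 1 and - (v + 1) has a positive image q + 1. *)
Lemma sum_gap_vertex t (h : nat -> rat) :
  \sum_(v < n.+1) h v =
  \sum_(q < n.+1) \sum_(g < n.+1.*2)
    (spval t (bump n.+1 g) == n.+1 + q.+1)%N%:R * h (gap_vertex n g).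
Proof.
rewrite exchange_big /=.
pose up x := (n.+1 < spval t x)%N.
have sum_q (g : 'I_n.+1.*2) :
    \sum_(q < n.+1) (spval t (bump n.+1 g) == n.+1 + q.+1)%N%:R * h (gap_vertex n g)
    = (up (bump n.+1 g))%:R * h (gap_vertex n g).
  rewrite -mulr_suml /up; congr (_ * _); set A := spval t _.
  have A_le : (A <= n.+1.*2)%N := spval_le t _.
  case: ltnP => hA.
    have q0lt : (A - n.+2 < n.+1)%N by lia.
    rewrite (bigD1 (Ordinal q0lt)) //= big1 ?addr0.
      by have -> : (A == n.+1 + (A - n.+2).+1)%N by lia.
    move=> q /eqP nq; case: eqP => // eqA; case: nq; apply: ord_inj => /=; lia.
  by rewrite big1 // => q _; have -> : (A == n.+1 + q.+1)%N = false by lia.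
rewrite (eq_bigr _ (fun g _ => sum_q g)).
rewrite -(big_mkord xpredT (fun g => (up (bump n.+1 g))%:R * h (gap_vertex n g))).
(* the gaps below and above zero give the negative and the positive points *)
rewrite (@big_cat_nat _ _ _ n.+1) //=; last by lia.
rewrite big_nat_rev [X in _ = _ + X](_ : _ = \sum_(0 <= v < n.+1)
   (up (n.+1 + v.+1)%N)%:R * h v); last first.
  rewrite -{1}[n.+1]add0n big_addn -addnn addnK; apply: eq_bigr => v _.
  rewrite /bump leq_addl /gap_vertex [(v + _ <= n)%N]leqNgt.
  have -> : (n < v + n.+1)%N by lia.
  by rewrite addnK; congr (_%:R * _); congr up; lia.
rewrite -big_split /= -(big_mkord xpredT h); apply: eq_big_nat => v /andP[_ vn].
rewrite add0n subSS /bump /gap_vertex.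
have -> : (n.+1 <= n - v)%N = false by lia.
rewrite leq_subr add0n subKn // -mulrDl.
suff -> : up (n - v)%N = ~~ up (n.+1 + v.+1)%N by case: (up _); rewrite ?add0r ?addr0 mul1r.
rewrite /up; have := @spval_rev n.+1 t (n.+1 + v.+1)%N; have := spval_le t (n.+1 + v.+1)%N.
have -> : (n.+1.*2 - (n.+1 + v.+1) = n - v)%N by lia.
have : spval t (n.+1 + v.+1) != n.+1.
  rewrite -[X in _ != X](spval_mid t); apply/eqP => /spval_inj; lia.
lia.
Qed.

(** The signed sum over the U that merge to U' is a difference of consecutive
values of L: the sum of the three cases for a cut is L g + ~ L (g + 1) - 1, and
otherwise the product of L g and ~ L (g + 1) is the same number, as L (g + 1)
implies L g when s has no descent at the merged edge. *)
Lemma sum_des_in_insert s (g q : nat) (U' : {set 'I_n}) (v := gap_vertex n g)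
    (t := insert_at (bump n.+1 g) (n.+1 + q.+1) s) : (g < n.+1.*2)%N -> (q <= n)%N ->
  \sum_U des_in t U * ((-1) ^+ (bit U v && bit U v.+1) * (merge_edges v U == U')%:R) =
  des_in s U' * ((before s q g)%:R - (before s q g.+1)%:R).
Proof.
move=> gn qn; have vn : (v <= n)%N := gap_vertex_le gn.
have [shift dv mono] := dsc_gap s gn qn; rewrite -/v -/t in shift dv mono.
rewrite sum_des_in_merge //.
rewrite (eq_bigr (fun j : 'I_n.+1 => dsc s j ==> bit U' j)) => [|j jv]; last by rewrite shift.
have -> : des_in s U' = ((dsc s v ==> bit U' v) &&
    \big[andb/true]_(j < n.+1 | j != v :> nat) (dsc s j ==> bit U' j))%:R.
  rewrite /des_in (@Des_sub _ _ _ n.+1) // (bigD1 (inord v)) //= inordK //.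
  congr (_ && _)%:R; apply: eq_bigl => j.
  by rewrite -(inj_eq (@ord_inj _)) inordK.
set r := \big[andb/true]_(j < _ | _) _.
have -> : (if bit U' v then (~~ dsc t v)%:R + (~~ dsc t v.+1)%:R - 1
   else (~~ dsc t v && ~~ dsc t v.+1)%:R) =
  (if bit U' v then (before s q g)%:R + (~~ before s q g.+1)%:R - 1
   else (before s q g && ~~ before s q g.+1)%:R) :> rat.
  case: dv => -[-> ->]; rewrite negbK // [_ && before _ _ _]andbC.
  by rewrite [_ + (before _ _ _)%:R]addrC.
case: (boolP (bit U' v)) => [uv|uv].
  by rewrite implybT; case: (r); case: (before _ _ _); case: (before _ _ _); rewrite /=; ring.
have vn' : (v < n)%N by rewrite ltnNge; apply: contra uv => /bit_out->.
move: (mono vn'); case: (dsc s v); case: (r); case: (before _ _ _); case: (before _ _ _) => h /=.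
all: try by have := h isT.
all: ring.
Qed.
End GapSums.

Section Commutation.
Variable n : nat.
Local Open Scope ring_scope.
Implicit Types (s : signed_perm n) (t : signed_perm n.+1).

(** Merging two edges loses one edge outside T, unless both edges are in T. *)
Lemma bit_sign_merge q (T : {set 'I_n.+1}) : (q <= n)%N ->
  bit_sign (bit T) n.+2 =
  - ((-1) ^+ (bit T q && bit T q.+1) * bit_sign (bit (merge_edges q T)) n.+1).
Proof.
move=> qn; rewrite /bit_sign (big_split_edge _ (fun i => (-1) ^+ (~~ bit T i)) qn).
rewrite [in RHS](bigD1 (inord q)) //= inordK // bit_merge_edges // ltnn eqxx.
rewrite [in RHS](eq_bigl (fun j : 'I_n.+1 => j != q :> nat)); last first.
  by move=> j; rewrite -(inj_eq (@ord_inj _)) inordK.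
rewrite [in RHS](eq_bigr (fun j : 'I_n.+1 => (-1) ^+ (~~ bit T (bump q.+1 j)))); last first.
  by move=> j jq; rewrite (bit_merge_edges_bump T qn jq).
rewrite /=; case: (bit T q); case: (bit T q.+1); rewrite /= ?expr0 ?expr1; ring.
Qed.

(** The inverse of an insertion is an insertion with the roles of the argument
and the image exchanged; the conditions at the two edges around the new image
say that the gap g lies in an interval. *)
Lemma alt_desV_insert s (g q : nat) (T : {set 'I_n.+1})
    (t := insert_at (bump n.+1 g) (n.+1 + q.+1) s) :
  (g < n.+1.*2)%N -> (q <= n)%N ->
  alt_desV T t = bit_sign (bit T) n.+2 *
   ((\big[andb/true]_(j < n.+1 | j != q :> nat) (bit (merge_edges q T) j || dsc s^-1%g j))%:R *
    ((bit T q || (g <= spval s^-1%g (n + q))%N) &&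
     (bit T q.+1 || (spval s^-1%g (n + q.+1) < g)%N))%:R).
Proof.
move=> gn qn; rewrite /alt_desV (@signr_bit _ _ n.+2) // (@setC_sub_Des _ _ _ n.+2) //.
have qE : (n.+1 + q.+1 = bump n.+1 (n + q.+1))%N by rewrite /bump; lia.
have Pz : nzpt n (n.+1 + q.+1) by rewrite qE bump_nz //; lia.
rewrite insert_atV ?bump_nz // (big_split_edge _ (fun i => bit T i || dsc _ i) qn) /=.
rewrite -natrM mulnb andbC; congr (_ * (_ && _)%:R).
  by apply: eq_bigr => j jq; rewrite (bit_merge_edges_bump T qn jq) dsc_insert_at_bump.
rewrite !dsc_insert_at // !ltnn !eqxx [(q.+1 < q)%N]ltnNge leqnSn gtn_eqF //=.
by case: (ltnP q n) => [//|nq]; rewrite [bit T q.+1]bit_out.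
Qed.

Lemma sum_window s (q : nat) (T : {set 'I_n.+1}) (U' : {set 'I_n})
    (t := fun g => insert_at (bump n.+1 g) (n.+1 + q.+1) s) : (q <= n)%N ->
  \sum_(g < n.+1.*2) alt_desV T (t g) *
    (des_in s U' * ((before s q g)%:R - (before s q g.+1)%:R)) =
  (-1) ^+ (bit T q && bit T q.+1) * (alt_desV (merge_edges q T) s * des_in s U').
Proof.
move=> qn; set a := bit T q; set b := bit T q.+1.
set y0 := spval s^-1%g (n + q); set y1 := spval s^-1%g (n + q.+1).
set r := \big[andb/true]_(j < n.+1 | j != q :> nat) (bit (merge_edges q T) j || dsc s^-1%g j).
have nq_b : ~~ b -> (q < n)%N.
  by rewrite ltnNge; apply: contra => nq; rewrite /b bit_out.
transitivity (bit_sign (bit T) n.+2 * r%:R * des_in s U' * \sum_(g < n.+1.*2)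
    ((a || (g <= y0)%N) && (b || (y1 < g)%N))%:R * ((before s q g)%:R - (before s q g.+1)%:R)).
  rewrite mulr_sumr; apply: eq_bigr => g _; rewrite alt_desV_insert // -/r -/a -/b -/y0 -/y1; ring.
have y0_le : (y0 <= n.*2)%N := spval_le _ _.
have y1_le : (y1 <= n.*2)%N := spval_le _ _.
rewrite telescope_window /before; first last.
- move=> /nq_b qn'; rewrite /= negb_or -leqNgt y1_le /y1 spval_Kinv; lia.
- by move=> _; rewrite /= /y0 spval_Kinv ?leqnn ?orbT //; lia.
- by rewrite /=; lia.
- by [].
- lia.
- lia.
have -> : alt_desV (merge_edges q T) s =
    bit_sign (bit (merge_edges q T)) n.+1 * (r && (a || b || (y1 < y0)%N))%:R.
  rewrite /alt_desV (@signr_bit _ _ n.+1) // (@setC_sub_Des _ _ _ n.+1) //; congr (_ * _%:R).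
  rewrite (bigD1 (inord q)) //= andbC; congr (_ && _).
    by apply: eq_bigl => j; rewrite -(inj_eq (@ord_inj _)) inordK.
  rewrite inordK // bit_merge_edges // ltnn eqxx -/a -/b /dsc -/y0 -/y1.
  by case: (boolP b) => [_|/nq_b->]; rewrite ?orbT.
by rewrite (bit_sign_merge T qn) -/a -/b; case: (r); case: (_ || _); rewrite /=; ring.
Qed.

(** Both sides are equal to a sum over the vertices q + 1 removed from T.  On
the left, every signed permutation of rank n + 1 is written as an insertion
with image q + 1. *)
Lemma reduced_adj_contraction (T : {set 'I_n.+1}) (U' : {set 'I_n}) :
  \sum_U reduced_adj T U * contraction U U' = \sum_W contraction T W * reduced_adj W U'.
Proof.
transitivity (\sum_(q < n.+1) (-1) ^+ (bit T q && bit T q.+1) * reduced_adj (merge_edges q T) U').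
  pose h t v : rat :=
    \sum_U des_in t U * ((-1) ^+ (bit U v && bit U v.+1) * (merge_edges v U == U')%:R).
  transitivity (\sum_t alt_desV T t * \sum_(v < n.+1) h t v).
    under eq_bigr do rewrite /reduced_adj mulr_suml.
    rewrite exchange_big; apply: eq_bigr => t _.
    rewrite /h exchange_big mulr_sumr; apply: eq_bigr => U _.
    by rewrite -mulrA /contraction -mulr_sumr.
  under eq_bigr => t _ do rewrite (sum_gap_vertex t) mulr_sumr.
  rewrite exchange_big; apply: eq_bigr => q _.
  have qn : (q <= n)%N by rewrite -ltnS.
  under eq_bigr do rewrite mulr_sumr.
  rewrite exchange_big /=.
  transitivity (\sum_(g < n.+1.*2) \sum_s alt_desV T (insert_at (bump n.+1 g) (n.+1 + q.+1) s) *
    (des_in s U' * ((before s q g)%:R - (before s q g.+1)%:R))).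
    apply: eq_bigr => g _.
    have qE : (n.+1 + q.+1 = bump n.+1 (n + q.+1))%N by rewrite /bump; lia.
    have Pz : nzpt n (n.+1 + q.+1) by rewrite qE bump_nz //; lia.
    rewrite -[RHS](eq_bigr _ (fun s _ => congr1 _ (sum_des_in_insert s U' (ltn_ord g) qn))).
    rewrite -(big_insert_at _ (fun t => alt_desV T t * h t (gap_vertex n g))) ?bump_nz //.
    rewrite [RHS]big_mkcond; apply: eq_bigr => t _.
    by case: ifP => _; rewrite ?mul1r // mul0r mulr0.
  rewrite exchange_big /reduced_adj mulr_sumr; apply: eq_bigr => s _.
  exact: sum_window.
by rewrite (sum_contraction (fun W => reduced_adj W U')).
Qed.
End Commutation.

(** * Rank of the derivation, and the theorem *)

Section Kernel.
Variable n : nat.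
Local Open Scope ring_scope.

Definition cons_bit (T : {set 'I_n}) : {set 'I_n.+1} :=
  setb n.+1 (fun i => (0 < i)%N && bit T i.-1).

Lemma bit_cons0 T : bit (cons_bit T) 0 = false.
Proof. by rewrite bit_setb. Qed.

Lemma bit_consS T i : bit (cons_bit T) i.+1 = bit T i.
Proof. by rewrite bit_setb ltnS /=; case: leqP => // /bit_out->. Qed.

(** Triangularity of D.  Let the first block of U have k points besides 0, and
add a point to this block.  In the expansion of D at the result, the removals of
the k + 1 points of the first block give back U, and the other terms have a first
block larger than that of U; so f U = 0 follows by induction on n - k. *)
Lemma contraction_kernel (f : {set 'I_n} -> rat) :
  (forall T, \sum_U contraction T U * f U = 0) -> forall U, f U = 0.
Proof.
move=> D0; suff main m U : (forall i, (i + m <= n)%N -> ~~ bit U i) -> f U = 0.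
  by move=> U; apply: (main n.+1) => i; rewrite addnS ltnNge leq_addl.
elim: m U => [|m IH] U U0.
  by have := U0 n; rewrite addn0 bit_out // => /(_ (leqnn n)).
have [|le_mn] := leqP n.+1 m.
  by move=> nm; apply: IH => i; rewrite leqNgt (leq_trans nm) ?leq_addl.
pose k := (n - m)%N; have kn : (k <= n)%N by rewrite leq_subr.
have Uk0 i : (i < k)%N -> bit U i = false.
  by move=> ik; apply/negbTE/U0; lia.
case: (boolP (bit U k)) => [Uk|nUk]; last first.
  apply: IH => i im; have [|ki|->] := ltngtP i k; rewrite ?nUk //.
    by move/Uk0->.
  by lia.
have := D0 (cons_bit U); rewrite sum_contraction.
rewrite (bigID (fun v : 'I_n.+1 => (v <= k)%N)) /= [X in _ + X]big1 ?addr0.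
  rewrite (eq_bigr (fun=> f U)) => [|v vk].
    rewrite sumr_const => /eqP; rewrite Num.Theory.mulrn_eq0 => /orP[|/eqP//].
    by rewrite eqn0Ngt => /negP[]; apply/card_gt0P; exists ord0.
  have -> : bit (cons_bit U) v = false.
    case: (nat_of_ord v) vk => [|w] wk; first by rewrite bit_cons0.
    by rewrite bit_consS Uk0.
  rewrite expr0 mul1r; congr f; apply: bit_inj => i lin.
  have vn : (v <= n)%N by rewrite -ltnS.
  rewrite bit_merge_edges // !bit_consS.
  case: (ltngtP i v) => // [iv|->].
    case: i lin iv => [|i] lin iv; first by rewrite bit_cons0 Uk0 // (leq_trans iv).
    by rewrite bit_consS !Uk0 //; lia.
  case: (nat_of_ord v) vk => [|w] wk; first by rewrite bit_cons0.
  by rewrite bit_consS Uk0.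
move=> v; rewrite -ltnNge => kv.
rewrite [f _]IH ?mulr0 // => i im.
have vn : (v <= n)%N by rewrite -ltnS.
have ik : (i <= k)%N by rewrite /k; lia.
rewrite bit_merge_edges // (leq_ltn_trans ik kv).
case: i {im} ik => [|i] ik; first by rewrite bit_cons0.
by rewrite bit_consS Uk0.
Qed.
End Kernel.

Section Matrices.
Local Open Scope ring_scope.

Definition mx_of (A B : finType) (f : A -> B -> rat) : 'M[rat]_(#|{: A}|, #|{: B}|) :=
  \matrix_(i, j) f (enum_val i) (enum_val j).

Lemma sum_enum_val (T : finType) (F : T -> rat) :
  \sum_x F x = \sum_(i < #|{: T}|) F (enum_val i).
Proof. by rewrite -big_enum_val. Qed.

Lemma mul_mx_of (A B C : finType) (f : A -> B -> rat) (g : B -> C -> rat) :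
  mx_of f *m mx_of g = mx_of (fun a c => \sum_b f a b * g b c).
Proof.
apply/matrixP => i j; rewrite !mxE.
rewrite [RHS]sum_enum_val.
by apply: eq_bigr => k _; rewrite !mxE.
Qed.

Lemma AdjB_factor n : AdjB n = mx_of (@des_in n) *m mx_of (@alt_desV n).
Proof.
rewrite mul_mx_of; apply/matrixP => i j; rewrite !mxE.
by rewrite sum_des_in_alt_desV.
Qed.

Lemma reduced_adj_factor n : mx_of (@reduced_adj n) = mx_of (@alt_desV n) *m mx_of (@des_in n).
Proof. by rewrite mul_mx_of. Qed.

Lemma row_full_contraction n : row_full (mx_of (@contraction n)).
Proof.
rewrite /row_full -mxrank_tr -/(row_free _) -kermx_eq0; apply/rowV0P => u.
rewrite sub_kermx => /eqP uD; apply/rowP => j; rewrite mxE.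
have := @contraction_kernel n (fun U => u 0 (enum_rank U)) _ (enum_val j).
rewrite enum_valK; apply=> T.
have uDT := congr1 (fun w : 'rV_ _ => w 0 (enum_rank T)) uD.
rewrite !mxE in uDT; rewrite -[RHS]uDT.
rewrite [LHS]sum_enum_val.
by apply: eq_bigr => k _; rewrite !mxE enum_rankK enum_valK mulrC.
Qed.

Lemma char_poly_reduced_dvd n :
  char_poly (mx_of (@reduced_adj n)) %| char_poly (mx_of (@reduced_adj n.+1)).
Proof.
apply: (char_poly_dvd_intertwine (row_full_contraction n)).
rewrite !mul_mx_of; apply/matrixP => i j; rewrite !mxE; exact: reduced_adj_contraction.
Qed.

Lemma card_signed_perm_ge n : (2 ^ n <= #|{: signed_perm n}|)%N.
Proof.
elim: n => [|n IH]; first by apply/card_gt0P; exists 1%g.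
by rewrite expnS mul2n (leq_trans _ (leq_double_card n)) // leq_double.
Qed.

Lemma char_poly_AdjB n :
  char_poly (AdjB n) = 'X^(#|{: signed_perm n}| - 2 ^ n) * char_poly (mx_of (@reduced_adj n)).
Proof.
have Xn0 : 'X^(2 ^ n) != 0 :> {poly rat} by rewrite -size_poly_eq0 size_polyXn.
apply: (mulIf Xn0); rewrite mulrAC -exprD subnK ?card_signed_perm_ge //.
have cardS : #|{: {set 'I_n}}| = (2 ^ n)%N.
  by rewrite -cardsT -powersetT card_powerset cardsT card_ord.
by rewrite AdjB_factor reduced_adj_factor -{1}cardS char_poly_mulmxC.
Qed.
End Matrices.

Theorem theorem1p1 (n : nat) :
  (char_poly (AdjB n) %| char_poly (AdjB n.+1))%R.
Proof.
rewrite !char_poly_AdjB dvdp_mul ?char_poly_reduced_dvd // dvdp_exp2l // expnS.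
have := leq_double_card n; have := card_signed_perm_ge n; lia.
Qed.
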